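(* Let $\rho$ be a good perturbation function with smooth best response map $\mathbf{br}$, let $(\beta_n)_{n\ge0}$ be a nondecreasing sequence of positive real numbers with $\beta_n\to+\infty$, and let $F$ be the set-valued map on $\mathbb{R}_+\times M$ given by $F(t,w)=F_{m(t)}(w)$, where $$F_n(x,y,\pi)=\big\{\big(\mathbf{br}(y,\beta_n)-x,\ \tau-y,\ \pi(\mathbf{br}(y,\beta_n),\tau)-\pi\big):\tau\in Y\big\}.$$ Let $A=\{(x,y,\pi)\in M:\Pi(y)-\pi\le0\}$. Then there exists a global uniform Lyapunov function $\Phi$ with respect to the compact set $A$ for the non-autonomous differential inclusion $\dot{\mathbf{w}}(s)\in F(s,\mathbf{w}(s))$.
   Context: Game. $I$, $L$ are finite nonempty sets, $\pi:I\times L\to\mathbb{R}$ a payoff function, $X=\Delta(I)$, $Y=\Delta(L)$ the simplices of probability vectors, $\pi$ extended bilinearly to $X\times Y$, $\Pi(y)=\max_{i\in I}\pi(i,y)$, $\|\pi\|_\infty=\max_{i,l}|\pi(i,l)|$, $M=X\times Y\times[-\|\pi\|_\infty,\|\pi\|_\infty]$. (The letter $\pi$ also denotes the third, real, coordinate of a point of $M$.) Time scale. $\gamma_n=1/n$, $\tau_0=0$, $\tau_n=\sum_{i=1}^n1/i$, $m(s)=\sup\{j\ge0:\tau_j\le s\}$. Good perturbation function. Let $Int(X)$ be the relative interior of $X$, $\partial X$ its relative boundary, $TX=\{h\in\mathbb{R}^I:\sum_ih_i=0\}$. A good perturbation function is a $C^2$ function $\rho:Int(X)\to\mathbb{R}$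 such that (1) there is $\lambda>0$ with $\langle D^2\rho(x)h,h\rangle\le-\lambda\|h\|^2$ for all $x\in Int(X)$, $h\in TX$; (2) $\|\nabla\rho(x)\|\to+\infty$ as $x\to\partial X$ (derivatives along $TX$). For $\beta>0$, $y\in Y$, $x\mapsto\pi(x,y)+\frac1\beta\rho(x)$ has a unique maximizer, lying in $Int(X)$, denoted $\mathbf{br}(y,\beta)$. A solution on $[a,b]$ is an absolutely continuous $\mathbf{w}:[a,b]\to M$ with $\dot{\mathbf{w}}(s)\in F(s,\mathbf{w}(s))$ for a.e. $s\in[a,b]$. Global uniform Lyapunov function with respect to a compact set $A\subset M$: a smooth map $\Phi:\mathbb{R}_+\times M\to\mathbb{R}_+$ such that (a) $A=\{w\in M:\exists s_n\uparrow+\infty,\ \lim_n\Phi(s_n,w)=0\}$; (b) there are maps $\lambda:(0,\infty)\to(0,1)$ and $\varepsilon:\mathbb{R}_+\times\mathbb{R}_+\to\mathbb{R}_+$ with $\lim_{T\to\infty}\lambda(T)=0$ and $\lim_{t\to\infty}\varepsilon(t,T)=0$ for all $T>0$, such that for all $t>0$, $T>0$ and every solution $\mathbf{w}$ on $[t,t+T]$, $\Phi(t+s,\mathbf{w}(t+s))\le\lambda(s)\Phi(t,\mathbf{w}(t))+\varepsilon(t,T)$ for all $s\in(0,T]$. *)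

(* Defs.v *)
From HB Require Import structures.
From mathcomp Require Import all_boot all_order all_algebra.
From mathcomp Require Import all_classical all_reals all_analysis.

Set Implicit Arguments.
Unset Strict Implicit.
Unset Printing Implicit Defensive.

Import Order.TTheory GRing.Theory Num.Theory numFieldNormedType.Exports.

Local Open Scope classical_set_scope.
Local Open Scope ring_scope.

(* Nonempty finite sets of actions are 'I_p.+1 and 'I_q.+1, vectors indexed by
   them are row vectors, and a payoff function is a matrix A; the library norm
   `|A| of a matrix is the maximum of the absolute values of its entries. *)

Section Smoothness.
Variables (R : realType) (V : normedModType R).
Implicit Types (U H S : set V) (f g : V -> R).

(* f is C^k on U, with derivatives taken along the directions in H. It is meant
   for H = setT and U open, or for H a subspace and U relatively open in an
   affine subspace of direction H; in both cases 'D_h f x with x in U and h in H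
   only depends on the values of f on U. *)
Fixpoint Ck_along H U (k : nat) f : Prop :=
  {within U, continuous f} /\
  match k with
  | 0 => True
  | k'.+1 => forall h, H h ->
      (forall x, U x -> derivable f x h) /\ Ck_along H U k' ('D_h f)
  end.

(* Smoothness on a set S that need not be open: f coincides on S with a
   C^infinity function defined on an open neighbourhood of S. *)
Definition smooth_on S f : Prop :=
  exists U g, [/\ open U, S `<=` U, forall k, Ck_along setT U k g
    & forall x, S x -> f x = g x].

End Smoothness.

Section AbsoluteContinuity.
Variables (R : realType) (V : normedModType R).

Definition absolutely_continuous_on (a b : R) (w : R -> V) : Prop :=
  forall e : R, 0 < e -> exists2 d : R, 0 < d &
  forall (n : nat) (u v : 'I_n -> R),
    (forall i, [/\ a <= u i, u i <= v i & v i <= b]) ->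
    trivIset setT (fun i => `]u i, v i[%classic) ->
    \sum_i (v i - u i) < d -> \sum_i `|w (v i) - w (u i)| < e.

(* A set-valued map F : R_+ x M -> E is a function F : R -> E -> set E whose
   values outside of R_+ x M are never used. *)
Definition solution (F : R -> V -> set V) (M : set V) (a b : R) (w : R -> V) :
    Prop :=
  [/\ forall s, a <= s <= b -> M (w s),
      absolutely_continuous_on a b w
    & \forall s \ae (@lebesgue_measure R), a <= s <= b ->
        derivable w s 1 /\ F s (w s) (derive1 w s)].

Definition global_uniform_lyapunov (F : R -> V -> set V) (M A : set V)
    (Phi : R * V -> R) : Prop :=
  [/\ compact A /\ A `<=` M,
      smooth_on [set p : R * V | 0 <= p.1 /\ M p.2] Phi,
      forall t w, 0 <= t -> M w -> 0 <= Phi (t, w),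
      A = [set w | M w /\ exists s : R^nat,
             [/\ forall n, 0 <= s n, nondecreasing_seq s, s @ \oo --> +oo
               & (fun n => Phi (s n, w)) @ \oo --> (0 : R)]]
    & exists (lam : R -> R) (eps : R -> R -> R),
      [/\ forall T, 0 < T -> 0 < lam T < 1,
          forall t T, 0 <= t -> 0 <= T -> 0 <= eps t T,
          lam T @[T --> +oo] --> (0 : R),
          forall T, 0 < T -> eps t T @[t --> +oo] --> (0 : R)
        & forall t T w, 0 < t -> 0 < T -> solution F M t (t + T) w ->
          forall s, 0 < s <= T ->
            Phi (t + s, w (t + s)) <= lam s * Phi (t, w t) + eps t T]].

End AbsoluteContinuity.

Section Perturbation.
Variables (R : realType) (p : nat).
Local Notation vect := 'rV[R]_p.+1.

Definition simplex : set vect :=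
  [set x | (forall i, 0 <= x 0 i) /\ \sum_i x 0 i = 1].

Definition simplex_int : set vect :=
  [set x | (forall i, 0 < x 0 i) /\ \sum_i x 0 i = 1].

Definition simplex_bd : set vect := simplex `\` simplex_int.

Definition tangent : set vect := [set h | \sum_i h 0 i = 0].

Definition dotr (u v : vect) : R := \sum_i u 0 i * v 0 i.

Definition norm2 (u : vect) : R := Num.sqrt (dotr u u).

(* The orthogonal projection of the i-th basis vector on tangent. *)
Definition tangent_proj (i : 'I_p.+1) : vect :=
  delta_mx 0 i - const_mx (p.+1%:R^-1).

(* The gradient along tangent: the vector g of tangent such that
   dotr g h = 'D_h rho x for all h in tangent. Its i-th coordinate is
   dotr g (delta_mx 0 i) = dotr g (tangent_proj i). *)
Definition tangent_grad (rho : vect -> R) (x : vect) : vect :=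
  \row_i 'D_(tangent_proj i) rho x.

(* Only the values of rho on simplex_int matter. *)
Definition good_perturbation (rho : vect -> R) : Prop :=
  [/\ Ck_along tangent simplex_int 2 rho,
      exists2 lam : R, 0 < lam &
        forall x h, simplex_int x -> tangent h ->
          'D_h ('D_h rho) x <= - lam * norm2 h ^+ 2
    & forall z : vect, simplex_bd z ->
        norm2 (tangent_grad rho x) @[x --> within simplex_int (nbhs z)] --> +oo].

(* simplex_int is the interior of simplex in its affine hull. *)
Lemma simplex_intE : simplex_int =
  [set x | simplex x /\ nbhs x [set z : vect | \sum_i z 0 i = 1 -> simplex z]].
Proof.
apply/seteqP; split=> x /=.
  move=> [x_gt0 x_sum]; split; first by split=> // i; exact: ltW.
  have : nbhs x [set z : vect | forall i, 0 < z 0 i].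
    have := @filter_forall vect 'I_p.+1 (fun i => [set z : vect | 0 < z 0 i]).
    move=> /(_ (nbhs x)); apply=> i.
    exact: (@coord_continuous R 1 p.+1 0 i x _ (lt_nbhsr (x_gt0 i))).
  by apply: filterS => z z_gt0 z_sum; split=> // i; exact: ltW.
move=> [[x_ge0 x_sum] x_nbhs]; split=> // i.
rewrite lt_neqAle x_ge0 andbT; apply/eqP => xi0.
have [j ji] : exists j, j != i.
  apply/not_existsP => all_i; move: x_sum; rewrite big1 => [/eqP|j _].
    by rewrite eq_sym oner_eq0.
  by have /negP := all_i j; rewrite negbK => /eqP ->.
pose v : vect := delta_mx 0 j - delta_mx 0 i.
have v_sum : \sum_k v 0 k = 0.
  have sum1 l : \sum_k (delta_mx 0 l : vect) 0 k = 1.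
    rewrite (bigD1 l) //= big1 ?addr0 ?mxE ?eqxx // => k /negPf kl.
    by rewrite mxE kl.
  under eq_bigr do rewrite mxE [X in _ + X]mxE.
  by rewrite big_split /= sumrN !sum1 subrr.
have /nbhs_ballP[e /= e_gt0 xe] := x_nbhs.
pose z := x + (e / 2) *: v.
have e2_gt0 : 0 < e / 2 by rewrite divr_gt0.
have : simplex z.
  apply: xe.
    rewrite mx_norm_ball /ball_ /= opprD addNKr normrN normrZ gtr0_norm //.
    apply: (@le_lt_trans _ _ (e / 2)); last by rewrite ltr_pdivrMr // ltr_pMr // ltr1n.
    rewrite ler_piMr ?(ltW e2_gt0) // [leLHS]mx_normrE; apply/bigmax_leP; split=> // -[a k] _ /=.
    rewrite !mxE; case: (_ && _); case: (_ && _);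
      by rewrite ?subrr ?subr0 ?sub0r ?normrN ?normr1 ?normr0.
  under eq_bigr do rewrite mxE [X in _ + X]mxE.
  by rewrite big_split /= x_sum -mulr_sumr v_sum mulr0 addr0.
move=> [/(_ i)]; rewrite !mxE -xi0 !eqxx eq_sym (negPf ji) /= add0r sub0r mulrN1.
by rewrite leNgt oppr_lt0 e2_gt0.
Qed.

End Perturbation.

Section Game.
Variables (R : realType) (p q : nat).
Local Notation state := ('rV[R]_p.+1 * 'rV[R]_q.+1 * R)%type.
Implicit Types (A : 'M[R]_(p.+1, q.+1)) (x : 'rV[R]_p.+1) (y : 'rV[R]_q.+1).

Definition payoff A x y : R := \sum_i \sum_l x 0 i * A i l * y 0 l.

(* payoff A (delta_mx 0 i) y is the payoff of the pure action i against y. *)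
Definition best_payoff A y : R :=
  \big[Num.max/payoff A (delta_mx 0 ord0) y]_i payoff A (delta_mx 0 i) y.

Definition state_space A : set state :=
  [set w | [/\ simplex w.1.1, simplex w.1.2 & - `|A| <= w.2 <= `|A|]].

Definition consistent_set A : set state :=
  [set w | state_space A w /\ best_payoff A w.1.2 - w.2 <= 0].

(* The maximizer of x |-> payoff A x y + rho x / b over simplex_int. *)
Definition br A (rho : 'rV[R]_p.+1 -> R) y (b : R) : 'rV[R]_p.+1 :=
  xget 0 [set x | simplex_int x /\ forall z, simplex_int z ->
    payoff A z y + b^-1 * rho z <= payoff A x y + b^-1 * rho x].

(* clock s is the greatest j such that 1 + 1/2 + ... + 1/j <= s: the j-th
   partial sum of harmonic, whose terms are 1/(k+1), is 1 + 1/2 + ... + 1/j. *)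
Definition clock (s : R) : nat :=
  xget 0%N [set j | series harmonic j <= s /\
                    forall k, series harmonic k <= s -> (k <= j)%N].

Definition smooth_br_map A (rho : 'rV[R]_p.+1 -> R) (beta : R^nat) (n : nat)
    (w : state) : set state :=
  let x' := br A rho w.1.2 (beta n) in
  [set (x' - w.1.1, tau - w.1.2, payoff A x' tau - w.2) | tau in @simplex R q].

Definition smooth_br_incl A rho beta (t : R) : state -> set state :=
  smooth_br_map A rho beta (clock t).

End Game.

(* Main.v *)
(** With theta_n = 1/beta_n, put Q_n(y) = max_x (A x y + theta_n rho(x)). Along a
    solution, and as long as n does not change, the envelope theorem gives
    (Q_n - pi)' <= - (Q_n - pi), once rho is normalized to be nonpositive. But Q_n
    jumps up whenever beta_n increases, and since rho may tend to -oo at the boundary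
    the jumps met along a solution need not have a small sum.

    They are absorbed by a corrector B_n(y): it has a small Lipschitz constant in y,
    it tends to a constant as n grows, up to a small error, and Q_n + B_n is
    nonincreasing in n. Correctors are built for the maximum of the perturbed payoff
    over a slice S of the simplex, on which some coordinates are fixed, by induction on
    the number of free coordinates. On a single point x, take - theta_n rho(x). In
    general, cut S by a fine grid of finitely many smaller slices; the maximum Q' over
    their union jumps by at most the sum of the jumps of the smaller slices, and by
    strict concavity the maximizers over S and over the union are at most one mesh
    apart (a longer segment between them would cross the grid), so that Q' - Q has a
    small Lipschitz constant. The sum of the correctors of the smaller slices, plus
    Q' - Q, is a corrector of S.

    Hence the gap Pi(y) - pi satisfies the Lyapunov inequality with lambda(s) = e^-s, up
    to an error that vanishes as t grows. The function Phi is a log-sum-exp smoothing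
    of the positive part of the gap, of precision O(1/(t+1)). *)

Require Import Defs.
From HB Require Import structures.
From mathcomp Require Import all_boot all_order all_algebra.
From mathcomp Require Import all_classical all_reals all_analysis.
From mathcomp Require Import ring lra.
Import Order.TTheory GRing.Theory Num.Theory numFieldNormedType.Exports.
Local Open Scope classical_set_scope.
Local Open Scope ring_scope.
Set Implicit Arguments.
Unset Strict Implicit.
Unset Printing Implicit Defensive.

(** * Row vectors, payoffs, and strongly concave functions on a line *)

Section RowVectors.
Variables (R : realType) (n : nat).
Implicit Types x y z : 'rV[R]_n.+1.

Lemma coord_le_norm x i : `|x 0 i| <= `|x|.
Proof.
rewrite [leRHS]/Num.Def.normr/= mx_normrE.
exact: (le_bigmax _ (fun k : 'I_1 * 'I_n.+1 => `|x k.1 k.2|) (0, i)).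
Qed.

Lemma norm_le_coord x (e : R) : 0 <= e -> (forall i, `|x 0 i| <= e) -> `|x| <= e.
Proof.
move=> e0 xe; rewrite [leLHS]/Num.Def.normr/= mx_normrE.
by rewrite (bigmax_le _ e0)//= => -[i j] _ /=; rewrite ord1.
Qed.

Lemma sum_continuous : continuous (fun x : 'rV[R]_n.+1 => \sum_i x 0 i).
Proof.
apply: (@continuous_big _ _ +%R 0 predT _ _ _ (fun i (x : 'rV[R]_n.+1) => x 0 i)).
  exact: add_continuous.
by move=> i _; exact: coord_continuous.
Qed.

Lemma simplex_intW x : simplex_int x -> simplex x.
Proof. by move=> [x0 x1]; split => // i; exact: ltW. Qed.

Lemma simplex_le1 x i : simplex x -> x 0 i <= 1.
Proof. by move=> [x0 <-]; rewrite (bigD1 i)//= lerDl sumr_ge0. Qed.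

Lemma simplex_norm x : simplex x -> `|x| <= 1.
Proof.
move=> xS; apply: norm_le_coord => // i.
by rewrite ger0_norm ?simplex_le1//; apply: xS.1.
Qed.

Lemma simplex_dist x y : simplex x -> simplex y -> `|x - y| <= 1.
Proof.
move=> xS yS; apply: norm_le_coord => // i; rewrite !mxE ler_norml.
have := xS.1 i; have := yS.1 i; have := simplex_le1 i xS.
have := simplex_le1 i yS; move=> *; lra.
Qed.

Lemma sum_segment x y (t : R) :
  \sum_i (x + t *: (y - x)) 0 i = \sum_i x 0 i + t * (\sum_i y 0 i - \sum_i x 0 i).
Proof.
rewrite mulrBr !mulr_sumr -sumrB -big_split /=.
by apply: eq_bigr => i _; rewrite !mxE mulrBr.
Qed.

Lemma simplex_int_segment x y (t : R) : simplex_int x -> simplex y ->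
  0 <= t < 1 -> simplex_int (x + t *: (y - x)).
Proof.
move=> [x0 x1] [y0 y1] /andP[t0 t1]; split=> [i|].
  rewrite !mxE; have := x0 i; have := y0 i => ? ?.
  have -> : x 0 i + t * (y 0 i - x 0 i) = (1 - t) * x 0 i + t * y 0 i by ring.
  by rewrite ltr_pwDl ?mulr_ge0 ?mulr_gt0// subr_gt0.
by rewrite sum_segment x1 y1 subrr mulr0 addr0.
Qed.

Lemma simplex_int_segment_closed x y (t : R) :
  simplex_int x -> simplex_int y -> 0 <= t <= 1 ->
  simplex_int (x + t *: (y - x)).
Proof.
move=> xI yI /andP[t0]; rewrite le_eqVlt => /predU1P[->|t1].
  by rewrite scale1r addrC subrK.
by apply: simplex_int_segment => //; [exact: simplex_intW|rewrite t0].
Qed.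

Lemma tangentB x y : \sum_i x 0 i = 1 -> \sum_i y 0 i = 1 -> tangent (y - x).
Proof.
move=> x1 y1; rewrite /tangent/=; under eq_bigr do rewrite !mxE.
by rewrite sumrB x1 y1 subrr.
Qed.

Lemma simplex_int_near x h : simplex_int x -> tangent h ->
  \forall s \near (0 : R), simplex_int (x + s *: h).
Proof.
move=> [x0 x1] h0.
have : \forall s \near (0 : R), forall i, 0 < x 0 i + s * h 0 i.
  have := @filter_forall R 'I_n.+1 (fun i => [set s : R | 0 < x 0 i + s * h 0 i]).
  move=> /(_ (nbhs 0)); apply=> i.
  have : (x 0 i + s * h 0 i) @[s --> (0 : R)] --> x 0 i + 0 * h 0 i.
    by apply: cvgD; [exact: cvg_cst|apply: cvgM; [exact: cvg_id|exact: cvg_cst]].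
  by rewrite mul0r addr0 => /cvgr_gt; exact.
apply: filterS => s xs; split=> [i|]; first by rewrite !mxE.
rewrite (eq_bigr (fun i => x 0 i + s * h 0 i)) => [|i _]; last by rewrite !mxE.
by rewrite big_split/= -mulr_sumr x1 (h0 : \sum_i h 0 i = 0) mulr0 addr0.
Qed.

(** Strong concavity is assumed in the Euclidean norm; this passes it to the maximum norm of the
    later estimates. *)
Lemma norm_le_norm2 x : `|x| ^+ 2 <= norm2 x ^+ 2.
Proof.
rewrite ler_pXn2r ?nnegrE ?sqrtr_ge0//; apply: norm_le_coord; rewrite ?sqrtr_ge0// => i.
rewrite -sqrtr_sqr ler_wsqrtr// /dotr (bigD1 i)//= -expr2 lerDl.
by rewrite sumr_ge0// => j _; rewrite -expr2 sqr_ge0.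
Qed.

Lemma barycenter_int : simplex_int (const_mx n.+1%:R^-1 : 'rV[R]_n.+1).
Proof.
split=> [i|]; first by rewrite mxE invr_gt0.
under eq_bigr do rewrite mxE.
by rewrite sumr_const card_ord -[_ *+ _]mulr_natr mulVf// pnatr_eq0.
Qed.

Lemma delta_simplex i : simplex (delta_mx 0 i : 'rV[R]_n.+1).
Proof.
split=> [j|]; first by rewrite mxE ler0n.
by rewrite (bigD1 i)//= mxE !eqxx big1 ?addr0// => j /negPf ji; rewrite mxE ji andbF.
Qed.

(** For [k = 0] this is the simplex; for [k > 0] it is a compact subset of the interior, on which
    [rho] attains its minimum. *)
Lemma simplex_ge_compact (k : R) :
  compact [set x : 'rV[R]_n.+1 | simplex x /\ forall i, k <= x 0 i].
Proof.
apply: bounded_closed_compact.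
  exists 1; split => // M M1 x [xS _] /=.
  by rewrite (le_trans (simplex_norm xS))// ltW.
have -> : [set x : 'rV[R]_n.+1 | simplex x /\ forall i, k <= x 0 i] =
    [set x | \sum_i x 0 i = 1] `&` \bigcap_i [set x | Num.max 0 k <= x 0 i].
  apply/seteqP; split=> x [] => [[x0 x1] kx|x1 kx].
    by split => // i _ /=; rewrite ge_max x0 kx.
  by split=> [|i]; [split => // i|]; have := kx i I; rewrite /= ge_max => /andP[].
apply: closedI.
  apply: (@closed_comp _ _ (fun x : 'rV[R]_n.+1 => \sum_i x 0 i) [set 1]); last exact: closed_eq.
  by move=> x _; apply: sum_continuous.
apply: closed_bigI => i _.
apply: (@closed_comp _ _ (fun x : 'rV[R]_n.+1 => x 0 i) [set t | Num.max 0 k <= t]); last exact: closed_ge.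
by move=> x _; exact: coord_continuous.
Qed.

Lemma simplex_compact : compact (@simplex R n).
Proof.
have -> : @simplex R n = [set x | simplex x /\ forall i, 0 <= x 0 i].
  by apply/seteqP; split=> x => [xS|[]//]; split => //; exact: xS.1.
exact: simplex_ge_compact.
Qed.

End RowVectors.

Section Payoff.
Variables (R : realType) (p q : nat) (A : 'M[R]_(p.+1, q.+1)).
Implicit Types (x u : 'rV[R]_p.+1) (y v : 'rV[R]_q.+1).

Lemma payoffE x y : payoff A x y = (x *m A *m y^T) 0 0.
Proof.
rewrite /payoff exchange_big mxE; apply: eq_bigr => l _.
by rewrite mxE mulr_suml mxE.
Qed.

Lemma payoffDl x u y : payoff A (x + u) y = payoff A x y + payoff A u y.
Proof. by rewrite !payoffE !mulmxDl mxE. Qed.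

Lemma payoffZl t x y : payoff A (t *: x) y = t * payoff A x y.
Proof. by rewrite !payoffE -!scalemxAl mxE. Qed.

Lemma payoffBl x u y : payoff A (x - u) y = payoff A x y - payoff A u y.
Proof. by rewrite -scaleN1r payoffDl payoffZl mulN1r. Qed.

Lemma payoffDr x y v : payoff A x (y + v) = payoff A x y + payoff A x v.
Proof. by rewrite !payoffE linearD mulmxDr mxE. Qed.

Lemma payoffZr t x y : payoff A x (t *: y) = t * payoff A x y.
Proof. by rewrite !payoffE linearZ -scalemxAr mxE. Qed.

Lemma payoffBr x y v : payoff A x (y - v) = payoff A x y - payoff A x v.
Proof. by rewrite -scaleN1r payoffDr payoffZr mulN1r. Qed.

Lemma payoff_convex x y : payoff A x y = \sum_i x 0 i * payoff A (delta_mx 0 i) y.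
Proof.
rewrite [in LHS](row_sum_delta x); elim/big_ind2 : _ => [|u1 s1 u2 s2 <- <-|i _].
- by rewrite -(scale0r 0) payoffZl mul0r.
- by rewrite payoffDl.
- by rewrite payoffZl.
Qed.

Lemma entry_le_norm i l : `|A i l| <= `|A|.
Proof.
rewrite [leRHS]/Num.Def.normr/= mx_normrE.
exact: (le_bigmax _ (fun k : 'I_p.+1 * 'I_q.+1 => `|A k.1 k.2|) (i, l)).
Qed.

Lemma payoff_simplex_norm x y : simplex x -> simplex y -> `|payoff A x y| <= `|A|.
Proof.
move=> [x0 x1] [y0 y1]; rewrite /payoff.
have -> : `|A| = \sum_i \sum_l x 0 i * `|A| * y 0 l.
  under eq_bigr do rewrite -mulr_sumr y1 mulr1.
  by rewrite -mulr_suml x1 mul1r.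
apply: (le_trans (ler_norm_sum _ _ _)); apply: ler_sum => i _.
apply: (le_trans (ler_norm_sum _ _ _)); apply: ler_sum => l _.
rewrite !normrM (ger0_norm (x0 i)) (ger0_norm (y0 l)).
by rewrite ler_wpM2r// ler_wpM2l// entry_le_norm.
Qed.

Definition payoff_bound : R := (p.+1 * q.+1)%:R * `|A|.

Lemma payoff_bound_ge0 : 0 <= payoff_bound.
Proof. by rewrite mulr_ge0. Qed.

Lemma payoff_norm x y : `|payoff A x y| <= payoff_bound * `|x| * `|y|.
Proof.
have -> : payoff_bound * `|x| * `|y| = \sum_(i < p.+1) \sum_(l < q.+1) `|x| * `|A| * `|y|.
  rewrite sumr_const card_ord sumr_const card_ord -mulrnA -[in RHS]mulr_natl /payoff_bound mulnC.
  by rewrite -!mulrA; congr (_ * _); rewrite mulrCA.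
apply: (le_trans (ler_norm_sum _ _ _)); apply: ler_sum => i _.
apply: (le_trans (ler_norm_sum _ _ _)); apply: ler_sum => l _.
rewrite !normrM; do 2?apply: ler_pM; rewrite ?mulr_ge0//.
- exact: coord_le_norm.
- exact: entry_le_norm.
- exact: coord_le_norm.
Qed.

Lemma payoff_norm_simplexl x y : simplex x -> `|payoff A x y| <= payoff_bound * `|y|.
Proof.
move=> xS; apply: (le_trans (payoff_norm _ _)).
by rewrite ler_wpM2r// ler_piMr ?payoff_bound_ge0// simplex_norm.
Qed.

End Payoff.

(** Adding [m / 2 * (s * s)] to [g] gives a function [k] with nonincreasing derivative; the mean
    value theorem on each side of [t] then shows that [k] is concave. *)
Lemma strongly_concave_line (R : realType) (g g1 g2 : R -> R) (m : R) :
  (forall s : R, 0 <= s <= 1 -> is_derive s 1 g (g1 s)) ->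
  (forall s : R, 0 <= s <= 1 -> is_derive s 1 g1 (g2 s)) ->
  (forall s, 0 <= s <= 1 -> g2 s <= - m) ->
  forall t, 0 <= t <= 1 ->
    (1 - t) * g 0 + t * g 1 + m / 2 * (t * (1 - t)) <= g t.
Proof.
move=> dg dg1 g2m t /andP[t0 t1].
pose k := fun s => g s + m / 2 * (s * s).
pose k1 := fun s => g1 s + m * s.
have dk (s : R) : 0 <= s <= 1 -> is_derive s 1 k (k1 s).
  move=> /dg ?; rewrite /k /k1.
  have h1 : is_derive s 1 ((m / 2) \*: (id * id : R -> R)) (m * s).
    by apply: is_derive_eq; rewrite /GRing.scale/=; field.
  exact: is_deriveD.
have dk1 (s : R) : 0 <= s <= 1 -> is_derive s 1 k1 (g2 s + m).
  move=> /dg1 ?; rewrite /k1.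
  have h1 : is_derive s 1 (m \*: (id : R -> R)) m.
    by apply: is_derive_eq; rewrite /GRing.scale/= mulr1.
  exact: is_deriveD.
have kc f df a b : 0 <= a -> b <= 1 -> (forall s : R, 0 <= s <= 1 -> is_derive s 1 f (df s : R)) ->
    {within `[a, b], continuous f}.
  move=> a0 b1 dfs; apply: derivable_within_continuous => s; rewrite in_itv/= => /andP[ls rs].
  by apply: (@ex_derive _ _ _ _ _ _ (df s)); apply: dfs; rewrite (le_trans a0 ls) (le_trans rs b1).
have mvt f df a b : 0 <= a -> b <= 1 -> a <= b ->
    (forall s : R, 0 <= s <= 1 -> is_derive s 1 f (df s : R)) ->
    exists2 c, a <= c <= b & f b - f a = df c * (b - a).
  move=> a0 b1 ab dfs.
  have dfo s : s \in `]a, b[ -> is_derive s 1 f (df s).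
    rewrite in_itv/= => /andP[ls rs]; apply: dfs.
    by rewrite (le_trans a0 (ltW ls)) (le_trans (ltW rs) b1).
  have [c] := MVT_segment ab dfo (kc f df a b a0 b1 dfs).
  by rewrite in_itv/= => cab E; exists c.
have [a /andP[a0 ta] ka] := mvt k k1 0 t (lexx 0) t1 t0 dk.
have [b /andP[tb b1] kb] := mvt k k1 t 1 t0 (lexx 1) t1 dk.
have [c /andP[ac cb] kc1] := mvt k1 _ a b a0 b1 (le_trans ta tb) dk1.
have k1ba : k1 b <= k1 a.
  rewrite -subr_le0 kc1 mulr_le0_ge0 ?subr_ge0 ?(le_trans ta)//.
  by rewrite -lerBrDr sub0r g2m// (le_trans a0 ac) (le_trans cb b1).
have : 0 <= t * (1 - t) * (k1 a - k1 b) by rewrite !mulr_ge0 ?subr_ge0.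
have -> : t * (1 - t) * (k1 a - k1 b) = (1 - t) * (k t - k 0) - t * (k 1 - k t).
  by rewrite ka kb subr0; ring.
rewrite /k; nra.
Qed.

(** * Good perturbation functions *)

Section GoodPerturbation.
Variables (R : realType) (p : nat) (rho : 'rV[R]_p.+1 -> R).
Hypothesis rho_good : good_perturbation rho.
Implicit Types (x y z h : 'rV[R]_p.+1).

(** The two difference quotients coincide, so derivability along the single direction [h]
    suffices. *)
Lemma line_is_derive (f : 'rV[R]_p.+1 -> R) x h (s : R) :
  derivable f (x + s *: h) h ->
  is_derive s 1 (fun t : R => f (x + t *: h)) ('D_h f (x + s *: h)).
Proof.
have E : (fun t : R => t^-1 *: (((fun t : R => f (x + t *: h)) \o shift s) (t *: 1) -
      f (x + s *: h))) =
    (fun t : R => t^-1 *: ((f \o shift (x + s *: h)) (t *: h) - f (x + s *: h))).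
  apply/funext => t /=; congr (_ *: (f _ - _)).
  by rewrite (_ : t *: 1 = t); [rewrite scalerDl addrCA|exact: mulr1].
by move=> df; apply: DeriveDef; rewrite /derivable/derive E.
Qed.

Lemma perturbation_continuous x : simplex_int x ->
  rho @ within (@simplex_int R p) (nbhs x) --> rho x.
Proof. by case: rho_good => -[/subspace_continuousP c _] _ _; exact: c. Qed.

Lemma perturbation_derivable x h : simplex_int x -> tangent h -> derivable rho x h.
Proof. by case: rho_good => -[_ d] _ _ xI /d[+ _]; exact. Qed.

Lemma perturbation_strongly_concave : exists2 lam : R, 0 < lam &
  forall x y t, simplex_int x -> simplex_int y -> 0 <= t <= 1 ->
  (1 - t) * rho x + t * rho y + lam * (t * (1 - t)) * `|y - x| ^+ 2 <=
  rho (x + t *: (y - x)).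
Proof.
case: rho_good => -[_ rho1] [lam lam0 rho2] _.
exists (lam / 2); first by rewrite divr_gt0.
move=> x y t xI yI t01; pose h := y - x.
have hT : tangent h by apply: tangentB; [exact: xI.2|exact: yI.2].
have [d1 [_ rho11]] := rho1 h hT; have [d2 _] := rho11 h hT.
have xs s : 0 <= s <= 1 -> simplex_int (x + s *: h).
  by move=> s01; exact: simplex_int_segment_closed.
have := @strongly_concave_line R (fun s => rho (x + s *: h))
  (fun s => 'D_h rho (x + s *: h)) (fun s => 'D_h ('D_h rho) (x + s *: h))
  (lam * `|h| ^+ 2).
have h1 (s : R) : 0 <= s <= 1 -> is_derive s 1 (fun s => rho (x + s *: h)) ('D_h rho (x + s *: h)).
  by move=> /xs sI; apply: line_is_derive; exact: d1.
have h2 (s : R) : 0 <= s <= 1 -> is_derive s 1 (fun s => 'D_h rho (x + s *: h)) ('D_h ('D_h rho) (x + s *: h)).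
  by move=> /xs sI; apply: (@line_is_derive ('D_h rho)); exact: d2.
move=> /(_ h1 h2) {h1 h2}; have h3 (s : R) : 0 <= s <= 1 -> 'D_h ('D_h rho) (x + s *: h) <= - (lam * `|h| ^+ 2).
  move=> /xs sI; apply: (le_trans (rho2 _ _ sI hT)); rewrite mulNr lerN2.
  by rewrite ler_pM2l// norm_le_norm2.
move=> /(_ h3 t t01); rewrite scale0r addr0 scale1r [x + h]addrC subrK.
by apply: le_trans; rewrite -/h le_eqVlt; apply/orP; left; apply/eqP; field.
Qed.

Lemma perturbation_concave x y t : simplex_int x -> simplex_int y -> 0 <= t <= 1 ->
  (1 - t) * rho x + t * rho y <= rho (x + t *: (y - x)).
Proof.
case: perturbation_strongly_concave => lam lam0 c xI yI t01.
apply: le_trans (c x y t xI yI t01); rewrite lerDl.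
by case/andP: t01 => t0 t1; rewrite !mulr_ge0 ?subr_ge0// ltW.
Qed.

(** [rho] has a minimum on a compact set [D] around the barycenter [c], and for every [x] the point
    [c] lies between [x] and a point of [D], so concavity at [c] bounds [rho x] from above. *)
Lemma perturbation_ub : exists K, forall x, simplex_int x -> rho x <= K.
Proof.
pose n : R := p.+1%:R; have n0 : 0 < n by rewrite ltr0Sn.
have n1 : 1 <= n by rewrite ler1n.
pose c : 'rV[R]_p.+1 := const_mx n^-1.
have cI : simplex_int c by exact: barycenter_int.
pose k := (2 * n)^-1.
have k0 : 0 < k by rewrite invr_gt0 mulr_gt0.
have kn : n^-1 = k + k by rewrite /k; field; rewrite gt_eqF.
pose D := [set x : 'rV[R]_p.+1 | simplex x /\ forall i, k <= x 0 i].
have Dint x : D x -> simplex_int x.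
  by move=> [[_ x1] kx]; split => // i; exact: lt_le_trans (kx i).
have cD : compact D by exact: simplex_ge_compact.
have cDc : D c by split; [exact: simplex_intW|move=> i; rewrite mxE kn lerDl ltW].
have [||w wD wmin] := @EVT_min_rV R _ rho D _ cD.
- by exists c.
- apply/subspace_continuousP => x Dx.
  by apply: cvg_trans (perturbation_continuous (Dint x Dx)); apply: cvg_app; exact: within_subset.
pose t := k / (1 + k).
have k1 : 0 < 1 + k by rewrite addr_gt0.
have t0 : 0 < t by rewrite divr_gt0.
have t1 : t < 1 by rewrite ltr_pdivrMr// mul1r ltrDr.
exists ((rho c - (1 - t) * rho w) / t) => x xI.
(* [u] lies beyond [c] as seen from [x], at [k] times the distance; hence [c] is at fraction
   [t = k / (1 + k)] from [u] to [x]. *)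
pose u := c - k *: (x - c).
have uD : D u.
  have ku i : k <= u 0 i.
    rewrite !mxE kn; have := simplex_le1 i (simplex_intW xI) => x1.
    have : k * (x 0 i - (k + k)) <= k * 1 by rewrite ler_pM2l//; lra.
    lra.
  split => //; split=> [i|]; first by rewrite (le_trans (ltW k0)).
  rewrite (_ : u = c + (- k) *: (x - c)); last by rewrite scaleNr.
  by rewrite sum_segment cI.2 xI.2 subrr mulr0 addr0.
have E : c = u + t *: (x - u).
  apply/rowP => i; rewrite !mxE /t; field; apply/andP; split; by rewrite gt_eqF.
have := perturbation_concave (Dint u uD) xI (_ : 0 <= t <= 1).
rewrite -E (ltW t0) (ltW t1) => /(_ isT) h.
rewrite ler_pdivlMr// lerBrDl; apply: le_trans h.
by rewrite [_ * t]mulrC lerD2r ler_pM2l ?subr_gt0// wmin// inE.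
Qed.

(** By concavity the difference quotients at steps shorter than [r] are at least the one at [r],
    hence at least [- K]. This holds along [e] and along [- e], which bounds the derivative on both
    sides. *)
Lemma perturbation_derive_bound x e (r K : R) : 0 < r -> tangent e ->
  simplex_int x -> simplex_int (x + r *: e) -> simplex_int (x - r *: e) ->
  rho x - r * K <= rho (x + r *: e) -> rho x - r * K <= rho (x - r *: e) ->
  `|'D_e rho x| <= K.
Proof.
move=> r0 eT xI xp xm hp hm.
have /cvgrPdist_lt dl : (fun h : R => h^-1 *: (rho (h *: e + x) - rho x)) @ 0^' --> 'D_e rho x.
  exact: (perturbation_derivable xI eT).
apply/ler_addgt0Pr => eps eps0.
have [d /= d0 hd] := dl eps eps0.
pose m := Num.min d r / 2.
have m0 : 0 < m by rewrite divr_gt0// lt_min d0.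
have md : m < d by rewrite ltr_pdivrMr// gt_min mulr_natr mulr2n ltrDl d0.
have mr : m <= r.
  by rewrite ler_pdivrMr// ge_min; apply/orP; right; rewrite mulr_natr mulr2n lerDl ltW.
clearbody m; have mr01 : 0 <= m / r <= 1.
  by rewrite divr_ge0 ?(ltW m0) ?(ltW r0)//= ler_pdivrMr// mul1r.
have side (e' : 'rV_p.+1) : simplex_int (x + r *: e') -> rho x - r * K <= rho (x + r *: e') ->
    - K <= m^-1 * (rho (m *: e' + x) - rho x).
  move=> xI' hK; have := perturbation_concave xI xI' mr01.
  rewrite [x + r *: e']addrC addrK scalerA divfK ?gt_eqF// [x + _]addrC => h.
  rewrite mulrC ler_pdivlMr//.
  have : m / r * (rho x - r * K) <= m / r * rho (r *: e' + x).
    by rewrite ler_pM2l ?divr_gt0// [r *: e' + x]addrC.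
  have -> : m / r * (rho x - r * K) = m / r * rho x - m * K by field; rewrite gt_eqF.
  lra.
have := hd m; rewrite /ball_ /= sub0r normrN (gtr0_norm m0) => /(_ md (lt0r_neq0 m0)).
have := hd (- m); rewrite /ball_ /= sub0r opprK (gtr0_norm m0) oppr_eq0 => /(_ md (lt0r_neq0 m0)).
have := side e xp hp.
have := side (- e); rewrite scalerN => /(_ xm hm).
rewrite scalerN -scaleNr invrN !scaleNr.
rewrite -[m^-1 *: (rho (m *: e + x) - rho x)]/(m^-1 * _).
rewrite -[m^-1 *: (rho (- (m *: e) + x) - rho x)]/(m^-1 * _).
set P := _ * (_ - _); set Q := _ * (_ - _) => hP hQ.
by rewrite !ltr_norml ler_norml => /andP[? ?] /andP[? ?]; apply/andP; split; lra.
Qed.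

End GoodPerturbation.

(** * Maximizers over slices of the simplex *)

Section PerturbedGame.
Variables (R : realType) (p q : nat) (A : 'M[R]_(p.+1, q.+1)).
Variable rho : 'rV[R]_p.+1 -> R.
Hypothesis rho_good : good_perturbation rho.
Implicit Types (x z u : 'rV[R]_p.+1) (y : 'rV[R]_q.+1) (J : {set 'I_p.+1}).

Definition perturbed_payoff (th : R) y x : R := payoff A x y + th * rho x.

(** The fixed coordinates are given by a point [z] instead of a list of values, so that a slice
    through an interior point is nonempty. *)
Definition slice z J : set 'rV[R]_p.+1 :=
  [set x | simplex_int x /\ forall i, i \in J -> x 0 i = z 0 i].

Lemma slice_self z J : simplex_int z -> slice z J z.
Proof. by []. Qed.

Lemma slice_int z J x : slice z J x -> simplex_int x.
Proof. by case. Qed.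

Lemma slice_segment z J x x' (t : R) : slice z J x -> slice z J x' -> 0 <= t <= 1 ->
  slice z J (x + t *: (x' - x)).
Proof.
move=> [xI xJ] [x'I x'J] t01; split; first exact: simplex_int_segment_closed.
by move=> i iJ; rewrite !mxE xJ// x'J// subrr mulr0 addr0.
Qed.

Lemma perturbed_payoff_concave (th : R) y x x' (t : R) : 0 < th ->
  simplex_int x -> simplex_int x' -> 0 <= t <= 1 ->
  (1 - t) * perturbed_payoff th y x + t * perturbed_payoff th y x' <=
  perturbed_payoff th y (x + t *: (x' - x)).
Proof.
move=> th0 xI x'I t01; have := perturbation_concave rho_good xI x'I t01.
rewrite -(ler_pM2l th0) /perturbed_payoff payoffDl payoffZl payoffBl; lra.
Qed.

Lemma perturbed_payoff_continuous (th : R) y x : simplex_int x -> forall e, 0 < e ->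
  exists2 d : R, 0 < d & forall x', simplex_int x' -> `|x' - x| < d ->
    `|perturbed_payoff th y x' - perturbed_payoff th y x| < e.
Proof.
move=> xI e e0.
pose e1 := e / 2 / (`|th| + 1).
have th1 : 0 < `|th| + 1 by rewrite ltr_wpDl.
have e1_gt0 : 0 < e1 by rewrite !divr_gt0.
have /cvgrPdist_lt/(_ _ e1_gt0) := perturbation_continuous rho_good xI.
rewrite near_withinE => /nbhs_ballP[d1 /= d10 h1].
pose C := payoff_bound A * `|y| + 1.
have C0 : 0 < C by rewrite ltr_wpDl// mulr_ge0// payoff_bound_ge0.
exists (Num.min d1 (e / 2 / C)); first by rewrite lt_min d10 !divr_gt0.
move=> x' x'I; rewrite lt_min => /andP[xd1 xd2].
have h2 : `|rho x' - rho x| < e1.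
  rewrite distrC; apply: h1 => //.
  by rewrite mx_norm_ball /ball_/= distrC.
have h3 : `|payoff A (x' - x) y| <= e / 2.
  apply: (le_trans (payoff_norm _ _ _)); rewrite mulrAC.
  apply: (@le_trans _ _ (C * `|x' - x|)).
    by rewrite ler_wpM2r// lerDl.
  by rewrite mulrC -ler_pdivlMr// ltW.
rewrite /perturbed_payoff opprD addrACA -payoffBl -mulrBr.
apply: (le_lt_trans (ler_normD _ _)); rewrite [ltRHS](splitr e).
apply: ler_ltD => //; rewrite normrM.
apply: (@le_lt_trans _ _ (`|th| * e1)); first by rewrite ler_wpM2l// ltW.
have -> : `|th| * e1 = e / 2 * (`|th| / (`|th| + 1)) by rewrite /e1; field; rewrite gt_eqF.
by rewrite gtr_pMr ?divr_gt0// ltr_pdivrMr// mul1r ltrDl.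
Qed.

(* The maximum cannot escape to a boundary point w: along the segment from w to z
   the objective would stay within a linear distance of its supremum, which
   by concavity bounds the gradient of rho there. *)
Lemma slice_argmax (th : R) y z J : 0 < th -> simplex_int z ->
  exists2 x, slice z J x &
    forall x', slice z J x' -> perturbed_payoff th y x' <= perturbed_payoff th y x.
Proof.
move=> th0 zI; pose f := perturbed_payoff th y; pose S := slice z J.
have zS : S z by exact: slice_self.
have [K rhoK] := perturbation_ub rho_good.
have supS : has_sup (f @` S).
  split; first by exists (f z), z.
  exists (payoff_bound A * `|y| + th * K) => _ [x [xI _] <-].
  rewrite lerD ?ler_pM2l ?rhoK//.
  apply: (le_trans (ler_norm _)).
  by apply: payoff_norm_simplexl; exact: simplex_intW.
pose m := sup (f @` S).
have fm x : S x -> f x <= m by move=> xS; apply: ub_le_sup; [exact: supS.2|exists x].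
(* [F] is generated by the sets of near-maximizers in [S]; compactness of the closed simplex gives
   it a cluster point [w], possibly on the boundary. *)
pose F : set_system 'rV[R]_p.+1 :=
  [set P | exists2 e : R, 0 < e & forall x, S x -> m - e < f x -> P x].
have FF : ProperFilter F.
  split; [move=> [e e0 h]|split].
  - by have [_ [x xS <-] /(h x xS)] := sup_adherent e0 supS.
  - by exists 1.
  - move=> P Q [e e0 hP] [e' e'0 hQ]; exists (Num.min e e'); first by rewrite lt_min e0.
    move=> x xS mx; split; [apply: hP|apply: hQ] => //; apply: le_lt_trans mx;
      by rewrite lerD2l lerN2 ge_min lexx ?orbT.
  - by move=> P Q PQ [e e0 hP]; exists e => // x xS /(hP x xS)/PQ.
have [w [wX wF]] : @simplex R p `&` cluster F !=set0.
  by apply: simplex_compact; exists 1 => // x /slice_int xI _; exact: simplex_intW.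
have key (d e : R) : 0 < d -> 0 < e -> exists x, [/\ S x, m - e < f x & `|x - w| < d].
  move=> d0 e0; have [||x [[xS mx] xd]] := wF [set x | S x /\ m - e < f x] (ball w d).
  - by exists e.
  - by apply/nbhs_ballP; exists d.
  - by exists x; split => //; move: xd; rewrite mx_norm_ball /ball_/= distrC.
have wJ i : i \in J -> w 0 i = z 0 i.
  move=> iJ; apply/eqP; rewrite -subr_eq0 -normr_le0.
  apply/ler_addgt0Pr => d d0; rewrite add0r.
  have [x [xS _ xw]] := key d 1 d0 ltr01.
  rewrite -(xS.2 i iJ) distrC; apply: le_trans (ltW xw).
  by have := coord_le_norm (x - w) i; rewrite !mxE.
(* Concavity between [w] and [u], with the supremum [m] in place of the value at [w]: use
   near-maximizers close to [w], and continuity at the interior point [w + s *: (u - w)]. *)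
have lower u s : simplex_int u -> 0 < s <= 1 -> (1 - s) * m + s * f u <= f (w + s *: (u - w)).
  move=> uI /andP[s0 s1]; apply/ler_addgt0Pr => e e0.
  have e20 : 0 < e / 2 by rewrite divr_gt0.
  have E a : a + s *: (u - a) = u + (1 - s) *: (a - u).
    by apply/rowP => i; rewrite !mxE; ring.
  have vI : simplex_int (w + s *: (u - w)).
    by rewrite E; apply: simplex_int_segment => //; apply/andP; split; lra.
  have [d d0 hd] := perturbed_payoff_continuous th y vI e20.
  have [x [xS mx xw]] := key d _ d0 e20.
  have x'I : simplex_int (x + s *: (u - x)).
    by apply: simplex_int_segment_closed => //; [exact: slice_int xS|rewrite ltW].
  have : `|x + s *: (u - x) - (w + s *: (u - w))| < d.
    have -> : x + s *: (u - x) - (w + s *: (u - w)) = (1 - s) *: (x - w).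
      by apply/rowP => i; rewrite !mxE; ring.
    rewrite normrZ ger0_norm ?subr_ge0//; apply: le_lt_trans xw.
    by rewrite ler_piMl// gerBl ltW.
  move=> /(hd _ x'I); rewrite -!/(f _) ltr_norml => /andP[_ h1].
  have := perturbed_payoff_concave y th0 (slice_int xS) uI (_ : 0 <= s <= 1).
  rewrite (ltW s0) s1 -!/(f _) => /(_ isT) h2.
  have : (1 - s) * (m - e / 2) <= (1 - s) * f x by rewrite ler_wpM2l ?subr_ge0// ltW.
  have : 0 <= s * e by rewrite mulr_ge0// ltW.
  lra.
have [wI|wNI] := pselect (simplex_int w).
  have wS : S w by [].
  exists w => // x xS; apply: (le_trans (fm x xS)).
  (* With [u = w], [lower] gives [m <= f w]. *)
  have := lower w (1 / 2) wI; rewrite subrr scaler0 addr0.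
  have -> : 0 < (1 : R) / 2 <= 1 by apply/andP; split; lra.
  by move=> /(_ isT); rewrite -/(f w); lra.
exfalso.
pose e i : 'rV[R]_p.+1 := tangent_proj R i.
have eT i : tangent (e i).
  rewrite /tangent/=; under eq_bigr do rewrite !mxE eqxx/=.
  rewrite sumrB (bigD1 i)//= eqxx big1 ?addr0; last by move=> j /negPf ->.
  by rewrite sumr_const card_ord -[_ *+ p.+1]mulr_natr mulVf ?subrr// pnatr_eq0.
(* The points [z + k *: e i] and [z - k *: e i] may leave the slice but stay in the interior, which
   is all that [lower] asks of [u]. *)
have [k k0 kI] : exists2 k : R, 0 < k &
    forall i, simplex_int (z + k *: e i) /\ simplex_int (z - k *: e i).
  have : \forall s \near (0 : R), forall i, simplex_int (z + s *: e i).
    have := @filter_forall R 'I_p.+1 (fun i => [set s : R | simplex_int (z + s *: e i)]).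
    by move=> /(_ (nbhs 0)); apply=> i; exact: simplex_int_near.
  move=> /nbhs_ballP[d /= d0 hd]; exists (d / 2); first by rewrite divr_gt0.
  have d2 : d / 2 < d by rewrite ltr_pdivrMr// ltr_pMr// ltr1n.
  move=> i; split; first by apply: hd; rewrite /ball/= sub0r normrN gtr0_norm ?divr_gt0.
  by rewrite -scaleNr; apply: hd; rewrite /ball/= sub0r opprK gtr0_norm ?divr_gt0.
pose K0 := \sum_i (`|f (z + k *: e i)| + `|f (z - k *: e i)|).
pose K1 := \sum_i `|payoff A (e i) y|.
pose K2 := (`|m| + K0 + k * K1) / (th * k).
have thk : 0 < th * k by rewrite mulr_gt0.
have grad s : 0 < s < 1 -> norm2 (tangent_grad rho (w + s *: (z - w))) <=
    Num.sqrt (p.+1%:R * K2 ^+ 2).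
  move=> /andP[s0 s1]; pose x := w + s *: (z - w).
  have s01 : 0 < s <= 1 by rewrite s0 ltW.
  have xI : simplex_int x.
    rewrite /x (_ : w + s *: (z - w) = z + (1 - s) *: (w - z)).
      by apply: simplex_int_segment => //; apply/andP; split; lra.
    by apply/rowP => i; rewrite !mxE; ring.
  have xS : S x by split => // i iJ; rewrite !mxE wJ// subrr mulr0 addr0.
  (* Moving by [s * k] along [g] from [x] leads to the point at fraction [s] from [w] to
     [z + k *: g]. There [lower] keeps [f] above [f x] up to a multiple of [s], so [rho] loses at
     most [s * k * K2], with [K2] independent of [s]. *)
  have bound (g : 'rV_p.+1) i : g = e i \/ g = - e i -> simplex_int (z + k *: g) ->
      simplex_int (x + (s * k) *: g) /\ rho x - s * k * K2 <= rho (x + (s * k) *: g).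
    move=> ge gI; have xg : x + (s * k) *: g = w + s *: (z + k *: g - w).
      by apply/rowP => j; rewrite !mxE; ring.
    split.
      rewrite xg (_ : _ + _ = (z + k *: g) + (1 - s) *: (w - (z + k *: g))).
        by apply: simplex_int_segment => //; apply/andP; split; lra.
      by apply/rowP => j; rewrite !mxE; ring.
    have := lower _ _ gI s01; rewrite -xg => h1.
    have h2 := fm x xS.
    have h3 : - K0 <= f (z + k *: g).
      rewrite lerNl; apply: (@le_trans _ _ `|f (z + k *: g)|).
        by rewrite -normrN ler_norm.
      rewrite /K0 (bigD1 i)//=; case: ge => ->; rewrite ?scalerN.
        by rewrite -addrA lerDl addr_ge0// sumr_ge0.
      by rewrite addrAC lerDr addr_ge0// sumr_ge0.
    have h4 : payoff A g y <= K1.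
      rewrite /K1 (bigD1 i)//=; apply: (@le_trans _ _ `|payoff A (e i) y|).
        case: ge => ->; first exact: ler_norm.
        by rewrite -scaleN1r payoffZl mulN1r -normrN ler_norm.
      by rewrite lerDl sumr_ge0.
    rewrite lerBlDr -lerBlDl -(ler_pM2l th0).
    have -> : th * (s * k * K2) = s * (`|m| + K0 + k * K1).
      by rewrite /K2; field; rewrite !gt_eqF.
    have h5 : s * - m <= s * `|m|.
      by rewrite ler_pM2l// -normrN ler_norm.
    have h5' : s * m <= s * `|m| by rewrite ler_pM2l// ler_norm.
    have h6 : s * - K0 <= s * f (z + k *: g) by rewrite ler_pM2l.
    have h7 : s * k * payoff A g y <= s * k * K1 by rewrite ler_pM2l// mulr_gt0.
    move: h1 h2; rewrite /f /perturbed_payoff -/(f _) -/(perturbed_payoff _ _ _) -/(f _).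
    rewrite payoffDl payoffZl; lra.
  rewrite /norm2 ler_wsqrtr// /dotr.
  have -> : p.+1%:R * K2 ^+ 2 = \sum_(i < p.+1) K2 ^+ 2.
    by rewrite sumr_const card_ord mulr_natl.
  apply: ler_sum => i _; rewrite !mxE -expr2.
  have [h1 h2] := bound (e i) i (or_introl erefl) (kI i).1.
  have := bound (- e i) i (or_intror erefl); rewrite !scalerN => /(_ (kI i).2)[h3 h4].
  have sk : 0 < s * k by rewrite mulr_gt0.
  have DK := perturbation_derive_bound rho_good sk (eT i) xI h1 h3 h2 h4.
  by rewrite -real_normK ?num_real// ler_pXn2r ?nnegrE// (le_trans _ DK).
(* The bound [grad] is uniform as [s] tends to [0], against the explosion of the gradient at the
   boundary point [w]. *)
case: rho_good => _ _ /(_ w (conj wX wNI)) /cvgryPgt /(_ (Num.sqrt (p.+1%:R * K2 ^+ 2))).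
rewrite near_withinE => /nbhs_ballP[d /= d0 hd].
pose s := Num.min (1 / 2) (d / 2).
have s0 : 0 < s by rewrite lt_min !divr_gt0.
have s1 : s < 1 by rewrite gt_min; apply/orP; left; lra.
have sd : s < d by rewrite gt_min; apply/orP; right; lra.
have := grad s; rewrite s0 s1 => /(_ isT); apply/negP; rewrite -ltNge; apply: hd.
  rewrite mx_norm_ball /ball_/= opprD addNKr normrN normrZ gtr0_norm//.
  by apply: le_lt_trans sd; rewrite ler_piMr ?(ltW s0)// simplex_dist//; exact: simplex_intW.
rewrite (_ : w + s *: (z - w) = z + (1 - s) *: (w - z)).
  by apply: simplex_int_segment => //; apply/andP; split; lra.
by apply/rowP => i; rewrite !mxE; ring.
Qed.

End PerturbedGame.

(** * Correctors *)

Lemma seq_argmax (R : realType) (T : eqType) (g : T -> R) (s : seq T) : s != [::] ->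
  exists2 x, x \in s & forall x', x' \in s -> g x' <= g x.
Proof.
elim: s => // a s IH _; case: (eqVneq s [::]) => [->|/IH[x xs xmax]].
  by exists a; rewrite ?inE// => x'; rewrite inE => /eqP ->.
have [ax|xa] := leP (g a) (g x).
  by exists x; rewrite ?inE ?xs ?orbT// => x'; rewrite inE => /predU1P[->|/xmax].
exists a; rewrite ?inE ?eqxx// => x'; rewrite inE => /predU1P[->//|/xmax h].
exact: le_trans (ltW xa).
Qed.

(** Cut the segment from [y] to [y'] into [N] equal pieces: the linear terms add up to the same
    bound, while the total of the quadratic ones is divided by [N]. *)
Lemma quadratic_lipschitz (R : realType) (V : normedModType R) (g : V -> R) (c L : R) :
  (forall y y', g y' - g y <= c * `|y' - y| + L * `|y' - y| ^+ 2) ->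
  forall y y', g y' - g y <= c * `|y' - y|.
Proof.
move=> hg y y'; apply/ler_addgt0Pr => e e0.
pose D := `|y' - y|; pose N := (Num.trunc (`|L| * D ^+ 2 / e)).+1.
have N0 : 0 < N%:R :> R by rewrite ltr0Sn.
pose w (k : nat) := y + (k%:R / N%:R) *: (y' - y).
have dw k : w k.+1 - w k = N%:R^-1 *: (y' - y).
  rewrite /w opprD addrACA subrr add0r -scalerBl; congr (_ *: _).
  by rewrite -mulrBl -natr1 addrAC subrr add0r mul1r.
have -> : g y' - g y = \sum_(0 <= k < N) (g (w k.+1) - g (w k)).
  rewrite telescope_sumr// /w mul0r scale0r addr0 divff ?gt_eqF// scale1r.
  by rewrite [y + _]addrC subrK.
apply: (@le_trans _ _ (\sum_(0 <= k < N) (c * (D / N%:R) + L * (D / N%:R) ^+ 2))).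
  apply: ler_sum => k _; apply: (le_trans (hg _ _)).
  by rewrite dw normrZ gtr0_norm ?invr_gt0// [_^-1 * _]mulrC.
rewrite sumr_const_nat subn0 -[_ *+ N]mulr_natl.
have -> : N%:R * (c * (D / N%:R) + L * (D / N%:R) ^+ 2) = c * D + L * D ^+ 2 / N%:R.
  by field; rewrite gt_eqF.
rewrite lerD2l; apply: (@le_trans _ _ (`|L| * D ^+ 2 / N%:R)).
  by rewrite ler_pM2r ?invr_gt0//; apply: ler_wpM2r; [apply: exprn_ge0; exact: normr_ge0|exact: ler_norm].
rewrite ler_pdivrMr// [leRHS]mulrC -ler_pdivrMr//.
by apply: ltW; apply: truncnS_gt.
Qed.

Section Corrector.
Variables (R : realType) (p q : nat) (A : 'M[R]_(p.+1, q.+1)).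
Variables (rho : 'rV[R]_p.+1 -> R) (K : R) (th : nat -> R).
Hypothesis rho_good : good_perturbation rho.
Hypothesis rhoK : forall x, simplex_int x -> rho x <= K.
Hypothesis th_gt0 : forall n, 0 < th n.
Hypothesis th_decr : forall n, th n.+1 <= th n.
Implicit Types (x z u : 'rV[R]_p.+1) (y : 'rV[R]_q.+1) (J : {set 'I_p.+1}).
Implicit Types (S : set 'rV[R]_p.+1) (n : nat).

(** Subtracting [K] leaves the maximizers unchanged and makes the perturbation term nonpositive on
    the interior. *)
Let f n y x := payoff A x y + th n * (rho x - K).

Definition is_argmax n y S x := S x /\ forall x', S x' -> f n y x' <= f n y x.

Definition maximizer n y S := xget 0 [set x | is_argmax n y S x].

Definition value n y S := f n y (maximizer n y S).

Definition maximizable S := forall n y, exists x, is_argmax n y S x.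

Lemma maximizerP n y S : maximizable S -> is_argmax n y S (maximizer n y S).
Proof. by move=> /(_ n y)[x xM]; exact: (xgetPex 0 (ex_intro _ x xM)). Qed.

Lemma slice_maximizable z J : simplex_int z -> maximizable (slice z J).
Proof.
move=> zI n y; have [x xS xM] := slice_argmax A rho_good y J (th_gt0 n) zI.
exists x; split => // x' /xM; rewrite /perturbed_payoff /f !mulrBr; lra.
Qed.

Lemma value_ge n y S x : maximizable S -> S x -> f n y x <= value n y S.
Proof. by move=> /(maximizerP n y)[_]; exact. Qed.

Lemma value_nondecreasing n y S : maximizable S -> S `<=` @simplex_int R p ->
  value n y S <= value n.+1 y S.
Proof.
move=> SM SI; have [mS _] := maximizerP n y SM.
apply: le_trans (value_ge n.+1 y SM mS); rewrite /value /f lerD2l.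
by apply: ler_wnM2r; rewrite ?subr_le0 ?rhoK//; exact: SI.
Qed.

(** Envelope theorem in finite differences: the maximizer at [y'] competes at [y], and the payoff is
    linear in [y]. *)
Lemma value_sub_le n y y' S : maximizable S ->
  value n y' S - value n y S <= payoff A (maximizer n y' S) (y' - y).
Proof.
move=> SM; have [mS _] := maximizerP n y' SM.
by have := value_ge n y SM mS; rewrite {2}/value /f payoffBr; lra.
Qed.

Lemma value_sub_ge n y y' S : maximizable S ->
  payoff A (maximizer n y S) (y' - y) <= value n y' S - value n y S.
Proof.
move=> SM; have := value_sub_le n y' y SM.
by rewrite !payoffBr; lra.
Qed.

(** Strong concavity at the midpoint of [x] and [x'], whose value cannot exceed the maximum
    [f n y x]. *)
Lemma slice_gap n : exists2 c : R, 0 < c & forall z J y x x',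
  is_argmax n y (slice z J) x -> slice z J x' ->
  f n y x' + c * `|x' - x| ^+ 2 <= f n y x.
Proof.
have [lam lam0 hlam] := perturbation_strongly_concave rho_good.
exists (th n * lam / 2); first by rewrite divr_gt0// mulr_gt0.
move=> z J y x x' [xS xM] x'S.
have h01 : 0 <= (1 / 2 : R) <= 1 by apply/andP; split; lra.
have := xM _ (slice_segment xS x'S h01).
have := hlam x x' _ (slice_int xS) (slice_int x'S) h01.
rewrite -(ler_pM2l (th_gt0 n)) /f payoffDl payoffZl payoffBl.
set N := `|_| ^+ 2; lra.
Qed.

(** In the sum of the quadratic gaps at [y] and [y'] everything cancels except
    [payoff A (x' - x) (y' - y)]. The constant [L] depends on [n], but it will only enter error
    terms that vanish in the limit. *)
Lemma maximizer_lipschitz n z J : simplex_int z -> exists2 L : R, 0 <= L & forall y y',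
  `|maximizer n y' (slice z J) - maximizer n y (slice z J)| <= L * `|y' - y|.
Proof.
move=> zI; have [c c0 gap] := slice_gap n; have SM := slice_maximizable J zI.
exists (payoff_bound A / (2 * c)); first by rewrite divr_ge0 ?payoff_bound_ge0// mulr_ge0// ltW.
move=> y y'; set x := maximizer n y _; set x' := maximizer n y' _.
have xM := maximizerP n y SM; have x'M := maximizerP n y' SM.
have h1 := gap _ _ _ _ _ xM x'M.1; have := gap _ _ _ _ _ x'M xM.1.
rewrite -/x -/x' in h1 *; rewrite distrC => h2.
have h3 : 2 * c * `|x' - x| ^+ 2 <= payoff A (x' - x) (y' - y).
  by move: h1 h2; rewrite /f !payoffBr !payoffBl; set N := `|_| ^+ 2; lra.
have := le_trans h3 (le_trans (ler_norm _) (payoff_norm _ _ _)).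
have [->|/eqP] := eqVneq x' x.
  by rewrite subrr normr0 => _; rewrite mulr_ge0// divr_ge0 ?payoff_bound_ge0// mulr_ge0// ltW.
move=> /eqP; rewrite -subr_eq0 -normr_gt0; set d := `|x' - x|; set D := `|y' - y| => d0 h.
have -> : payoff_bound A / (2 * c) * D = payoff_bound A * D / (2 * c) by field; rewrite gt_eqF.
rewrite ler_pdivlMr ?mulr_gt0// -(ler_pM2r d0); move: h; rewrite expr2; lra.
Qed.

(** The Lipschitz constant is common to all [n]. The lower bound serves to make the nonincreasing
    sequence [B n y + value n y S] converge at a fixed [y]. *)
Definition corrector S (c : R) (B : nat -> 'rV[R]_q.+1 -> R) :=
  [/\ forall n y, B n.+1 y + value n.+1 y S <= B n y + value n y S,
      forall n y y', B n y' - B n y <= c * `|y' - y|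
    & exists M, forall n y, simplex y -> - M <= B n y].

(** One slice is recorded for every pair of a free coordinate and a grid value that some point of
    [slice z J] realizes, such a point being chosen to represent it. *)
Lemma grid_slices z J (m : nat) : simplex_int z -> J != [set: 'I_p.+1]%SET ->
  exists s : seq ('rV[R]_p.+1 * {set 'I_p.+1}),
  [/\ exists2 t, t \in s & slice t.1 t.2 z,
      forall t, t \in s -> slice z J t.1 /\ exists2 i, i \notin J & t.2 = i |: J
    & forall x i (k : 'I_m.+1), i \notin J -> slice z J x -> x 0 i = k%:R / m%:R ->
        exists2 t, t \in s & slice t.1 t.2 x].
Proof.
move=> zI; rewrite -finset.subTset => /subsetPn[i0 _ i0J].
pose P (ik : 'I_p.+1 * 'I_m.+1) := exists x, slice z J x /\ x 0 ik.1 = ik.2%:R / m%:R.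
pose g ik := if pselect (P ik) is left h then Some (projT1 (cid h), ik.1 |: J) else None.
(* The head entry puts [z] in the union, which is thus nonempty even if no point chosen from the
   grid is available. *)
exists ((z, i0 |: J) :: pmap g [seq ik <- enum {: 'I_p.+1 * 'I_m.+1} | ik.1 \notin J]).
split.
- by exists (z, i0 |: J); [rewrite inE eqxx|exact: slice_self].
- move=> t; rewrite inE => /predU1P[->/=|].
    by split; [exact: slice_self|exists i0].
  rewrite mem_pmap => /mapP[ik]; rewrite mem_filter => /andP[ikJ _].
  rewrite /g; case: pselect => // h [->]/=.
  by split; [exact: (projT2 (cid h)).1|exists ik.1].
- move=> x i k iJ xS xik.
  have h : P (i, k) by exists x.
  exists (projT1 (cid h), i |: J).
    rewrite inE; apply/orP; right; rewrite mem_pmap; apply/mapP; exists (i, k).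
      by rewrite mem_filter iJ mem_enum.
    by rewrite /g; case: pselect => // h'; rewrite (Prop_irrelevance h h').
  have [x'S x'ik] := projT2 (cid h); split; first exact: slice_int xS.
  move=> j; rewrite in_setU1 => /predU1P[->|jJ]; first by rewrite x'ik.
  by rewrite xS.2// x'S.2.
Qed.

Lemma grid_between (m : nat) (a b : R) : (0 < m)%N -> 0 <= a -> b <= 1 -> m%:R^-1 < b - a ->
  exists k : 'I_m.+1, a < k%:R / m%:R < b.
Proof.
move=> m0 a0 b1 ab; have m0' : 0 < m%:R :> R by rewrite ltr0n.
pose k := (Num.trunc (a * m%:R)).+1.
have am : 0 <= a * m%:R by rewrite mulr_ge0.
have k1 : a * m%:R < k%:R by apply: truncnS_gt.
have k2 : k%:R <= a * m%:R + 1.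
  by rewrite /k -natr1 lerD2r; have /andP[] := truncn_itv am.
have k3 : k%:R < b * m%:R.
  apply: (le_lt_trans k2).
  by move: ab; rewrite -(ltr_pM2r m0') mulVf ?gt_eqF// mulrBl; lra.
have km : (k < m.+1)%N.
  rewrite ltnS -(ler_nat R); apply: (le_trans (ltW k3)).
  by rewrite ler_piMl// ltW.
by exists (Ordinal km) => /=; rewrite ltr_pdivlMr// k1 ltr_pdivrMr.
Qed.

Section Union.
Variables (z : 'rV[R]_p.+1) (J : {set 'I_p.+1}) (m : nat).
Variable s : seq ('rV[R]_p.+1 * {set 'I_p.+1}).
Hypotheses (zI : simplex_int z) (m_gt0 : (0 < m)%N).
Hypothesis s_z : exists2 t, t \in s & slice t.1 t.2 z.
Hypothesis s_sub : forall t, t \in s ->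
  slice z J t.1 /\ exists2 i, i \notin J & t.2 = i |: J.
Hypothesis s_grid : forall x i (k : 'I_m.+1), i \notin J -> slice z J x ->
  x 0 i = k%:R / m%:R -> exists2 t, t \in s & slice t.1 t.2 x.

Let S := slice z J.
Let W : set 'rV[R]_p.+1 := [set x | exists2 t, t \in s & slice t.1 t.2 x].

Lemma union_sub : W `<=` S.
Proof.
move=> x [t ts xt]; have [tS [i iJ tE]] := s_sub ts.
split; first exact: slice_int xt.
by move=> j jJ; rewrite xt.2 ?tE ?in_setU1 ?jJ ?orbT// tS.2.
Qed.

Lemma union_part_maximizable t : t \in s -> maximizable (slice t.1 t.2).
Proof. by move=> /s_sub[[tI _] _]; exact: slice_maximizable. Qed.

Lemma union_maximizable : maximizable W.
Proof.
move=> n y; have s0 : s != [::] by case: s_z => t + _; apply: contraTneq => ->.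
have [t ts tmax] := seq_argmax (fun t => value n y (slice t.1 t.2)) s0.
have [mS mM] := maximizerP n y (union_part_maximizable ts).
exists (maximizer n y (slice t.1 t.2)); split; first by exists t.
move=> x [t' t's xt']; apply: le_trans (tmax t' t's).
exact: value_ge (union_part_maximizable t's) xt'.
Qed.

(* Otherwise the open segment between the two maximizers crosses a slice of the
   grid, where by strict concavity the objective exceeds its maximum over W. *)
Lemma union_maximizer_close n y :
  `|maximizer n y W - maximizer n y S| <= m%:R^-1.
Proof.
have SM : maximizable S by exact: slice_maximizable.
have m0 : 0 < m%:R^-1 :> R by rewrite invr_gt0 ltr0n.
have [xW xmax] := maximizerP n y union_maximizable.
have [x0S x0max] := maximizerP n y SM.
set x := maximizer n y W in xW xmax *; set x0 := maximizer n y S in x0S x0max *.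
apply: norm_le_coord => [|i]; first exact: ltW.
rewrite leNgt; apply/negP => far.
have xS : S x := union_sub xW.
have iJ : i \notin J.
  apply/negP => iJ; move: far.
  by rewrite !mxE xS.2// x0S.2// subrr normr0 ltNge ltW.
(* Coordinate [i] changes by more than one mesh, so it takes a grid value strictly inside the
   segment; [t] solves the linear equation for that value. *)
have [t t01 [k tk]] : exists2 t : R, 0 < t < 1 &
    exists k : 'I_m.+1, (x0 + t *: (x - x0)) 0 i = k%:R / m%:R.
  have bnd u : S u -> 0 <= u 0 i <= 1.
    move=> /slice_int uI; rewrite (ltW (uI.1 i)) simplex_le1//.
    exact: simplex_intW.
  have /andP[x0_0 x0_1] := bnd _ x0S; have /andP[x_0 x_1] := bnd _ xS.
  move: far; rewrite !mxE; case: (ltP (x0 0 i) (x 0 i)) => [lt|le].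
    rewrite gtr0_norm ?subr_gt0// => /(grid_between m_gt0 x0_0 x_1)[k /andP[k1 k2]].
    exists ((k%:R / m%:R - x0 0 i) / (x 0 i - x0 0 i)).
      by rewrite divr_gt0 ?subr_gt0//= ltr_pdivrMr ?subr_gt0// mul1r ltrD2r.
    by exists k; rewrite !mxE divfK ?subr_eq0 ?gt_eqF// addrC subrK.
  rewrite ler0_norm ?subr_le0// opprB => far.
  have lt : x 0 i < x0 0 i by rewrite -subr_gt0 (lt_trans m0).
  have [k /andP[k1 k2]] := grid_between m_gt0 x_0 x0_1 far.
  exists ((x0 0 i - k%:R / m%:R) / (x0 0 i - x 0 i)).
    by rewrite divr_gt0 ?subr_gt0//= ltr_pdivrMr ?subr_gt0// mul1r ltrD2l ltrN2.
  have mn0 : m%:R != 0 :> R by rewrite pnatr_eq0 -lt0n.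
  have dn0 : x0 0 i - x 0 i != 0 by rewrite subr_eq0 gt_eqF.
  by exists k; rewrite !mxE; field; rewrite ?mn0 ?dn0.
have /andP[t0 t1] := t01; have t01' : 0 <= t <= 1 by rewrite !ltW.
have wS := slice_segment x0S xS t01'.
have := xmax _ (s_grid iJ wS tk).
have [lam lam0 hlam] := perturbation_strongly_concave rho_good.
have := hlam _ _ _ (slice_int x0S) (slice_int xS) t01'.
rewrite -(ler_pM2l (th_gt0 n)) => h1 h2.
have d0 : 0 < `|x - x0| by apply: lt_le_trans (lt_trans m0 far) (coord_le_norm _ _).
have : 0 < th n * (lam * (t * (1 - t)) * `|x - x0| ^+ 2).
  by rewrite !mulr_gt0// ?subr_gt0// exprn_gt0.
have := x0max _ xS => h3.
have : (1 - t) * f n y x <= (1 - t) * f n y x0 by rewrite ler_pM2l// subr_gt0.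
move: h1 h2; rewrite /f payoffDl payoffZl payoffBl.
set N := _ * `|_| ^+ 2; lra.
Qed.

(** Half of [c] is spent on the correctors of the pieces, and half on [value n y W - value n y S],
    whose slope in [y] is the payoff of the difference of two maximizers at most one mesh apart. *)
Lemma union_corrector (c : R) (B : _ -> nat -> 'rV[R]_q.+1 -> R) : 0 < c ->
  payoff_bound A / m%:R <= c / 2 ->
  (forall t, t \in s -> corrector (slice t.1 t.2) (c / 2 / (size s)%:R) (B t)) ->
  corrector S c (fun n y => \sum_(t <- s) B t n y + (value n y W - value n y S)).
Proof.
move=> c0 mc sB.
have SM : maximizable S by exact: slice_maximizable.
have WM := union_maximizable.
have size0 : 0 < (size s)%:R :> R.
  by rewrite ltr0n; case: s_z => t; case: (s).
split.
- move=> n y; suff : \sum_(t <- s) B t n.+1 y + value n.+1 y W <=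
      \sum_(t <- s) B t n y + value n y W by lra.
  pose D t := value n.+1 y (slice t.1 t.2) - value n y (slice t.1 t.2).
  have D0 t : t \in s -> 0 <= D t.
    move=> ts; rewrite subr_ge0 value_nondecreasing//; first exact: union_part_maximizable.
    by move=> x; exact: slice_int.
  (* The maximizer over [W] at stage [n.+1] lies in one piece [t], so the jump over [W] is at most
     [D t]; the other jumps are nonnegative. *)
  have WD : value n.+1 y W - value n y W <= \sum_(t <- s) D t.
    have [[t ts mt] _] := maximizerP n.+1 y WM.
    rewrite (big_rem t)//= -[leLHS]addr0 lerD//; last first.
      by rewrite big_seq sumr_ge0// => t' /mem_rem; exact: D0.
    apply: lerB; first exact: value_ge (union_part_maximizable ts) mt.
    have [mt' _] := maximizerP n y (union_part_maximizable ts).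
    by apply: value_ge => //; exists t.
  have : \sum_(t <- s) B t n.+1 y <= \sum_(t <- s) (B t n y - D t).
    rewrite big_seq [leRHS]big_seq; apply: ler_sum => t ts.
    by have [+ _ _] := sB t ts; move=> /(_ n y); rewrite /D; lra.
  by rewrite sumrB; lra.
- move=> n y y'.
  have [L L0 lip] := maximizer_lipschitz n J zI.
  have h : value n y' W - value n y' S - (value n y W - value n y S) <= c / 2 * `|y' - y|.
    apply: (@quadratic_lipschitz _ _ (fun y => value n y W - value n y S) _ (payoff_bound A * L)).
    move=> {}y {}y'.
    have h1 := value_sub_le n y y' WM; have h2 := value_sub_ge n y y' SM.
    (* The first term is controlled by the mesh. The second compares maximizers over [S] at [y] and
       [y'], hence is quadratic in [y' - y] and is removed by [quadratic_lipschitz]. *)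
    apply: (@le_trans _ _ (payoff A (maximizer n y' W - maximizer n y' S) (y' - y) +
       payoff A (maximizer n y' S - maximizer n y S) (y' - y))).
      by rewrite !payoffBl; lra.
    apply: lerD; apply: (le_trans (ler_norm _)); apply: (le_trans (payoff_norm _ _ _)).
      rewrite ler_wpM2r//; apply: le_trans mc.
      by rewrite ler_wpM2l ?payoff_bound_ge0// union_maximizer_close.
    by rewrite expr2 mulrA ler_wpM2r// -mulrA ler_wpM2l ?payoff_bound_ge0.
  have h' : \sum_(t <- s) B t n y' - \sum_(t <- s) B t n y <= c / 2 * `|y' - y|.
    rewrite -sumrB; apply: (@le_trans _ _ (\sum_(t <- s) (c / 2 / (size s)%:R * `|y' - y|))).
      rewrite big_seq [leRHS]big_seq; apply: ler_sum => t ts.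
      by have [_ + _] := sB t ts; exact.
    rewrite big_const_seq count_predT iter_addr_0 -[_ *+ _]mulr_natl.
    by rewrite le_eqVlt; apply/orP; left; apply/eqP; field; rewrite gt_eqF.
  lra.
- have [M hM] : exists M, forall n y, simplex y -> - M <= \sum_(t <- s) B t n y.
    move: sB; move: (c / 2 / (size s)%:R) => c1; elim: (s) => [_|t s' IH sB'].
      by exists 0 => n y _; rewrite big_nil oppr0.
    have [|M1 h1] := IH; first by move=> t' t's; apply: sB'; rewrite inE t's orbT.
    have [_ _ [M2 h2]] := sB' t (mem_head _ _).
    exists (M1 + M2) => n y yS; rewrite big_cons.
    by have := h1 n y yS; have := h2 n y yS; lra.
  exists (M + 2 * `|A| + th 0%N * (K - rho z)) => n y yS.
  have h1 := value_ge n y WM (s_z : W z).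
  have h2 : - `|A| <= payoff A z y.
    rewrite lerNl; apply: le_trans (payoff_simplex_norm A (simplex_intW zI) yS).
    by rewrite -normrN ler_norm.
  have h3 : th n * (K - rho z) <= th 0%N * (K - rho z).
    rewrite ler_wpM2r ?subr_ge0 ?rhoK//.
    by elim: n {h1} => // n; exact: le_trans.
  have [x0S _] := maximizerP n y SM.
  have h4 : value n y S <= `|A|.
    have h5 := payoff_simplex_norm A (simplex_intW (slice_int x0S)) yS.
    apply: le_trans h5; apply: le_trans (ler_norm _).
    have hr : rho (maximizer n y S) - K <= 0 by rewrite subr_le0 rhoK//; exact: slice_int x0S.
    by rewrite /value /f gerDl mulr_ge0_le0// ltW.
  have := hM n y yS; move: h1; rewrite /f; lra.
Qed.

End Union.

(** The induction keeps [c] general, since the pieces need the smaller constant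
    [c / 2 / (size s)%:R]. *)
Lemma slice_corrector z J (c : R) : simplex_int z -> 0 < c ->
  exists B, corrector (slice z J) c B.
Proof.
have [k] := ubnP #|~: J|; elim: k => // k IH in z J c *; rewrite ltnS => Jk zI c0.
have [JT|JT] := eqVneq J [set: 'I_p.+1]%SET.
  (* The slice is the single point [z], and this corrector plus the value is [payoff A z y], which
     does not depend on [n]. *)
  exists (fun n y => - (th n * (rho z - K))).
  have mE n y : maximizer n y (slice z J) = z.
    have [[_ mz] _] := maximizerP n y (slice_maximizable J zI).
    by apply/rowP => i; rewrite mz// JT.
  split.
  - by move=> n y; rewrite /value !mE /f; lra.
  - by move=> n y y'; rewrite subrr mulr_ge0// ltW.
  - exists 0 => n y _; rewrite oppr0 oppr_ge0 mulr_ge0_le0 ?subr_le0 ?rhoK//.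
    exact: ltW.
pose m := (Num.trunc (payoff_bound A / (c / 2))).+1.
have [s [sz ssub sgrid]] := grid_slices m zI JT.
have s0 : 0 < (size s)%:R :> R.
  by rewrite ltr0n; case: sz => t; case: (s).
have [B hB] : exists B, forall t, t \in s -> corrector (slice t.1 t.2) (c / 2 / (size s)%:R) (B t).
  have /choice[B hB] : forall t, exists B : nat -> 'rV[R]_q.+1 -> R,
      t \in s -> corrector (slice t.1 t.2) (c / 2 / (size s)%:R) B.
    move=> t; have [ts|ts] := boolP (t \in s); last by exists (fun _ _ => 0).
    have [[tI _] [i iJ tE]] := ssub t ts.
    have lt : (#|~: t.2| < k)%N.
      apply: leq_trans Jk; rewrite tE; apply: proper_card; apply/properP; split.
        by rewrite finset.setCS finset.subsetUr.
      by exists i; rewrite !inE ?eqxx ?iJ.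
    have c'0 : 0 < c / 2 / (size s)%:R by rewrite !divr_gt0.
    by have [B hB] := IH t.1 t.2 _ lt tI c'0; exists B.
  by exists B.
eexists; apply: (union_corrector zI _ sz ssub sgrid c0 _ hB) => //.
rewrite ler_pdivrMr ?ltr0Sn// [leRHS]mulrC -ler_pdivrMr ?divr_gt0//.
by apply: ltW; apply: truncnS_gt.
Qed.

End Corrector.

(** * The unperturbed best payoff *)

Section BestPayoff.
Variables (R : realType) (p q : nat) (A : 'M[R]_(p.+1, q.+1)).
Implicit Types (x : 'rV[R]_p.+1) (y : 'rV[R]_q.+1).

Lemma le_best_payoff y i : payoff A (delta_mx 0 i) y <= best_payoff A y.
Proof. exact: (le_bigmax _ (fun i => payoff A (delta_mx 0 i) y)). Qed.

Lemma best_payoff_le y (M : R) :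
  (forall i, payoff A (delta_mx 0 i) y <= M) -> best_payoff A y <= M.
Proof. by move=> h; apply: bigmax_le => // i _; exact: h. Qed.

Lemma payoff_le_best x y : simplex x -> payoff A x y <= best_payoff A y.
Proof.
move=> [x0 x1]; rewrite payoff_convex.
apply: (@le_trans _ _ (\sum_i x 0 i * best_payoff A y)); last by rewrite -mulr_suml x1 mul1r.
by apply: ler_sum => i _; rewrite ler_wpM2l// le_best_payoff.
Qed.

Lemma best_payoff_norm y : simplex y -> `|best_payoff A y| <= `|A|.
Proof.
move=> yS; have h i := payoff_simplex_norm A (delta_simplex R i) yS.
rewrite ler_norml; apply/andP; split.
  by apply: le_trans (le_best_payoff y ord0); have := h ord0; rewrite ler_norml => /andP[].
by apply: best_payoff_le => i; exact: le_trans (ler_norm _) (h i).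
Qed.

End BestPayoff.

(** * Values and correctors on the whole simplex *)

Section Corrected.
Variables (R : realType) (p q : nat) (A : 'M[R]_(p.+1, q.+1)).
Variables (rho : 'rV[R]_p.+1 -> R) (K : R) (th : nat -> R).
Hypothesis rho_good : good_perturbation rho.
Hypothesis rhoK : forall x, simplex_int x -> rho x <= K.
Hypothesis th_gt0 : forall n, 0 < th n.
Hypothesis th_decr : forall n, th n.+1 <= th n.
Hypothesis th_cvg0 : forall e, 0 < e -> exists N, forall n, (N <= n)%N -> th n < e.
Variable z : 'rV[R]_p.+1.
Hypothesis zI : simplex_int z.
Implicit Types (x : 'rV[R]_p.+1) (y : 'rV[R]_q.+1).

Let S := slice z finset.set0.
Let val n y := value A rho K th n y S.

Let SM : maximizable A rho K th S.
Proof. exact: slice_maximizable. Qed.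

Let SI x : simplex_int x -> S x.
Proof. by split => // i; rewrite inE. Qed.

Lemma value_le_payoff n y :
  val n y <= payoff A (maximizer A rho K th n y S) y.
Proof.
have [mS _] := maximizerP n y SM; rewrite /val /value gerDl.
by rewrite mulr_ge0_le0 ?subr_le0 ?rhoK//; [exact: ltW|exact: slice_int mS].
Qed.

Lemma value_le_best n y : simplex y -> val n y <= best_payoff A y.
Proof.
move=> yS; apply: (le_trans (value_le_payoff n y)); apply: payoff_le_best.
by have [mS _] := maximizerP n y SM; exact: simplex_intW (slice_int mS).
Qed.

(** [rho] may be unbounded near the vertices, so each vertex is first moved by a fraction [t]
    towards the interior point [z], at a payoff cost of at most [e / 2]. At these finitely many
    points a small [th n] makes the perturbation cost at most another [e / 2], uniformly in [y]. *)
Lemma value_cvg_best e : 0 < e -> exists N, forall n y, (N <= n)%N -> simplex y ->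
  best_payoff A y - e <= val n y.
Proof.
move=> e0; have A1 : 0 < `|A| + 1 by rewrite ltr_wpDl.
pose t := Num.min 1 (e / 4 / (`|A| + 1)).
have t0 : 0 < t by rewrite lt_min ltr01 !divr_gt0.
have t1 : t <= 1 by rewrite ge_min lexx.
have te : t * (2 * `|A|) <= e / 2.
  apply: (@le_trans _ _ (e / 4 / (`|A| + 1) * (2 * (`|A| + 1)))).
    apply: ler_pM; rewrite ?(ltW t0) ?mulr_ge0//; first by rewrite ge_min lexx orbT.
    by rewrite ler_pM2l// lerDl.
  by rewrite le_eqVlt; apply/orP; left; apply/eqP; field; rewrite gt_eqF.
pose zi i : 'rV[R]_p.+1 := delta_mx 0 i + t *: (z - delta_mx 0 i).
have ziI i : simplex_int (zi i).
  have -> : zi i = z + (1 - t) *: (delta_mx 0 i - z).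
    by apply/rowP => j; rewrite !mxE; ring.
  apply: simplex_int_segment => //; first exact: delta_simplex.
  by apply/andP; split; lra.
pose M := \sum_i (K - rho (zi i)) + 1.
have M0 i : K - rho (zi i) <= M.
  rewrite /M (bigD1 i)//= -addrA lerDl addr_ge0// sumr_ge0// => j _.
  by rewrite subr_ge0 rhoK.
have M1 : 0 < M by rewrite ltr_wpDl// sumr_ge0// => j _; rewrite subr_ge0 rhoK.
have [N hN] := th_cvg0 (divr_gt0 (divr_gt0 e0 (ltr0n R 2)) M1).
exists N => n y /hN thn yS; rewrite lerBlDr; apply: best_payoff_le => i.
have := value_ge n y SM (SI (ziI i)); rewrite -/(val n y) /zi payoffDl payoffZl payoffBl.
have h1 := payoff_simplex_norm A (simplex_intW zI) yS.
have h2 := payoff_simplex_norm A (delta_simplex R i) yS.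
have h3 : - (2 * `|A|) <= payoff A z y - payoff A (delta_mx 0 i) y.
  by move: h1 h2; rewrite !ler_norml => /andP[? ?] /andP[? ?]; lra.
have h4 : t * - (2 * `|A|) <= t * (payoff A z y - payoff A (delta_mx 0 i) y).
  by rewrite ler_pM2l.
have h5 : th n * (K - rho (zi i)) <= e / 2.
  apply: (@le_trans _ _ (th n * M)); first by rewrite ler_pM2l.
  by rewrite -ler_pdivlMr// ltW.
rewrite -/(zi i); lra.
Qed.

(** At a reference strategy [y0], [B n y0 + val n y0] is nonincreasing and bounded below while
    [val n y0] tends to the best payoff, so [B n y0] tends to a constant [k], which is subtracted.
    In [2 * c], one [c] pays for the two limits at [y0] and one for the distance from [y0] to
    [y]. *)
Lemma normalized_corrector (c : R) : 0 < c -> exists2 B, corrector A rho K th S c B &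
  exists N, forall n y, (N <= n)%N -> simplex y -> `|B n y| <= 2 * c.
Proof.
move=> c0; have [B [B1 B2 [M B3]]] := slice_corrector A rho_good rhoK th_gt0 th_decr finset.set0 zI c0.
pose y0 : 'rV[R]_q.+1 := delta_mx 0 ord0.
have y0S : simplex y0 by exact: delta_simplex.
pose G n := B n y0 + val n y0.
have [N1 hN1] := value_cvg_best (divr_gt0 c0 (ltr0n R 2)).
have Gdecr : nonincreasing_seq G.
  by apply/nonincreasing_seqP => n; exact: B1.
have [z0 z0S] : exists x, S x by exists z; exact: slice_self.
have Gcvg : G @ \oo --> inf (range G).
  apply: nonincreasing_cvgn => //.
  exists (- M + (payoff A z y0 + th 0%N * (rho z - K))) => _ [n _ <-].
  apply: lerD; first exact: B3.
  have := value_ge n y0 SM (SI zI); apply: le_trans; rewrite lerD2l.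
  have h : th n <= th 0%N by elim: n => // n; exact: le_trans.
  by apply: ler_wnM2r => //; rewrite subr_le0 rhoK.
pose k := inf (range G) - best_payoff A y0.
have /cvgrPdist_lt/(_ _ (divr_gt0 c0 (ltr0n R 2)))[N2 _ hN2] := Gcvg.
exists (fun n y => B n y - k).
  split.
  - by move=> n y; have := B1 n y; lra.
  - by move=> n y y'; have := B2 n y y'; lra.
  - by exists (M + k) => n y /(B3 n); lra.
exists (maxn N1 N2) => n y; rewrite geq_max => /andP[n1 n2] yS.
have h1 := hN1 n y0 n1 y0S; have h2 := value_le_best n y0S.
have := hN2 n n2; rewrite /= ltr_norml => /andP[h3 h4].
have hd : c * `|y - y0| <= c by rewrite ler_piMr ?(ltW c0)// simplex_dist.
have h5 := B2 n y0 y; have := B2 n y y0; rewrite distrC => h6.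
move: h1 h2 h3 h4; rewrite ler_norml /k /G => *; apply/andP; split; lra.
Qed.

End Corrected.

(** * The clock *)

Section Clock.
Variable R : realType.
Implicit Types (s t v : R) (n k : nat).

Lemma series_harmonic_increasing n : series (@harmonic R) n < series harmonic n.+1.
Proof. by rewrite seriesSr ltrDl harmonic_gt0. Qed.

Lemma series_harmonic_mono n k : (n <= k)%N -> series (@harmonic R) n <= series harmonic k.
Proof.
by apply: (homo_leq (r := fun a b => a <= b) _ le_trans) => // ?; exact: ltW (series_harmonic_increasing _).
Qed.

Lemma series_harmonic_unbounded s : exists n, s < series harmonic n.
Proof.
apply: contrapT => /forallNP h; apply: (@dvg_harmonic R).
apply: nondecreasing_is_cvgn; first exact: series_harmonic_mono.
by exists s => _ [n _ <-]; rewrite leNgt; apply/negP; exact: h.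
Qed.

(** Divergence of the harmonic series bounds the candidates, so a greatest one exists and [clock]
    does not fall back on its default value. *)
Lemma clockP s : 0 <= s -> series harmonic (clock s) <= s /\
  forall k, series harmonic k <= s -> (k <= clock s)%N.
Proof.
move=> s0; pose P := fun j => series harmonic j <= s.
have exP : exists n, P n by exists 0%N; rewrite /P /series/= big_geq.
have [N sN] := series_harmonic_unbounded s.
have ubP n : P n -> (n <= N)%N.
  move=> Pn; rewrite leqNgt; apply/negP => /ltnW/series_harmonic_mono Nn.
  by have := lt_le_trans sN (le_trans Nn Pn); rewrite ltxx.
case: (ex_maxnP exP ubP) => j Pj jmax.
exact: (xgetPex 0%N (ex_intro [set j | series harmonic j <= s /\
  forall k, series harmonic k <= s -> (k <= j)%N] j (conj Pj jmax))).
Qed.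

Lemma clock_nondecreasing s t : 0 <= s -> s <= t -> (clock s <= clock t)%N.
Proof.
move=> s0 st; apply: (clockP (le_trans s0 st)).2.
exact: le_trans (clockP s0).1 st.
Qed.

(** Only to the right: at a positive partial sum of the harmonic series the clock has just
    jumped. *)
Lemma clock_right_constant s : 0 <= s -> exists2 d : R, 0 < d &
  forall v, s <= v -> v < s + d -> clock v = clock s.
Proof.
move=> s0; have [h1 h2] := clockP s0.
exists (series harmonic (clock s).+1 - s).
  by rewrite subr_gt0 ltNge; apply/negP => /h2; rewrite ltnn.
move=> v sv; rewrite addrC subrK => vs; apply/eqP; rewrite eqn_leq; apply/andP; split; last exact: clock_nondecreasing.
rewrite -ltnS ltnNge; apply/negP => /series_harmonic_mono h.
have := lt_le_trans vs (le_trans h (clockP (le_trans s0 sv)).1).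
by rewrite ltxx.
Qed.

Lemma clock_cvgy n : exists2 t0 : R, 0 <= t0 & forall t, t0 <= t -> (n <= clock t)%N.
Proof.
have h : 0 <= series (@harmonic R) n.
  by have := series_harmonic_mono (leq0n n); apply: le_trans; rewrite /series/= big_geq.
by exists (series harmonic n) => // t ht; apply: (clockP (le_trans h ht)).2.
Qed.

End Clock.

(** * Functions with nonpositive slope almost everywhere *)

Section AbsolutelyContinuousMonotone.
Variables (R : realType) (U : R -> R) (a b : R).
Hypothesis ab : a <= b.

Let mu := @lebesgue_measure R.

(* Upper bound on the increment of U up to s: slope e outside of the open set W,
   and finitely many disjoint intervals of W. *)
Let covered (W : set R) (e s : R) := exists n (u v : nat -> R),
  [/\ forall i, (i < n)%N -> [/\ a <= u i, u i <= v i & v i <= s],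
      forall i j, (i < j < n)%N -> v i <= u j,
      forall i, (i < n)%N -> `]u i, v i[ `<=` W
    & U s - U a <= e * (s - a) + \sum_(i < n) (U (v i) - U (u i))].

(** The intervals are disjoint and inside [W], so a small measure of [W] brings them within reach of
    absolute continuity. *)
Let covered_length (W : set R) n (u v : nat -> R) : open W ->
  (forall i, (i < n)%N -> u i <= v i) ->
  (forall i j, (i < j < n)%N -> v i <= u j) ->
  (forall i, (i < n)%N -> `]u i, v i[ `<=` W) ->
  trivIset setT (fun i : 'I_n => `]u i, v i[%classic) /\
  ((\sum_(i < n) (v i - u i))%:E <= mu W)%E.
Proof.
move=> oW uv vu uvW.
have tI : trivIset setT (fun i : 'I_n => `]u i, v i[%classic).
  have disj (i j : 'I_n) s : (i < j)%N -> `]u i, v i[%classic s -> `]u j, v j[%classic s -> False.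
    rewrite /= !in_itv/= => ij /andP[_ svi] /andP[ujs _].
    have := vu i j; rewrite ij ltn_ord => /(_ isT) viuj.
    by have := lt_trans (lt_le_trans svi viuj) ujs; rewrite ltxx.
  move=> i j _ _ [s [si sj]].
  case: (ltngtP i j) => [ij|ji|/val_inj //]; first by have := disj _ _ _ ij si sj.
  by have := disj _ _ _ ji sj si.
split => //; have mI (i : 'I_n) : measurable (`]u i, v i[%classic : set R) by [].
have mUI : measurable (\big[setU/set0]_(i < n) (`]u i, v i[%classic : set R)).
  by apply: bigsetU_measurable.
have : (mu (\big[setU/set0]_(i < n) (`]u i, v i[%classic : set R)) <= mu W)%E.
  apply: le_measure; rewrite ?inE//; first exact: measurable_realfun.open_measurable.
  by move=> s; rewrite -(bigcup_mkord n (fun i => `]u i, v i[%classic)) => -[i ni]; exact: uvW.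
apply: le_trans; rewrite /mu (measure_semi_additive_ord (@lebesgue_measure R) mI tI mUI).
rewrite -sumEFin; apply: lee_sum => i _.
rewrite [leRHS](@lebesgue_measure_itv R `]u i, v i[)/= lte_fin.
have := uv _ (ltn_ord i); rewrite le_eqVlt => /predU1P[->|->]; last by rewrite EFinB.
by rewrite ltxx subrr.
Qed.

(** Both assumptions bound increments from above only, so that [U] may jump downwards. The
    exceptional null set is enclosed in an open set [W] of small measure: absolute continuity
    controls the intervals of [W], the slope bound handles the other points, and a supremum argument
    reaches [b]. *)
Lemma upper_ac_nonincreasing :
  (forall e, 0 < e -> exists2 d : R, 0 < d &
    forall (n : nat) (u v : 'I_n -> R),
      (forall i, [/\ a <= u i, u i <= v i & v i <= b]) ->
      trivIset setT (fun i => `]u i, v i[%classic) ->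
      \sum_i (v i - u i) < d -> \sum_i (U (v i) - U (u i)) <= e) ->
  (\forall s \ae (@lebesgue_measure R), a <= s <= b ->
    forall e, 0 < e -> exists2 d : R, 0 < d &
      forall z v, a <= z <= s -> s <= v <= b -> s - d < z -> v < s + d ->
        U v - U z <= e * (v - z)) ->
  U b <= U a.
Proof.
move=> ac [N [mN N0 sN]].
apply/ler_addgt0Pr => e0 e0_gt0.
pose e := e0 / (b - a + 1).
have ba1 : 0 < b - a + 1 by rewrite ltr_wpDl ?subr_ge0.
have e_gt0 : 0 < e by rewrite divr_gt0.
suff : U b - U a <= e * (b - a) + e.
  have -> : e * (b - a) + e = e0 by rewrite /e; field; rewrite gt_eqF.
  by rewrite lerBlDl.
have [d d0 acd] := ac e e_gt0.
have Ny : (mu N < +oo)%E by rewrite /mu N0.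
have [W [oW NW muW]] := lebesgue_regularity_outer mN Ny d0.
have mW : measurable W by exact: measurable_realfun.open_measurable.
have muW' : (mu W < d%:E)%E.
  rewrite /mu -(setDKU NW) measureU//; [|exact: measurableD|by rewrite setDKI].
  by rewrite /mu/= N0 adde0.
suff [n [u [v [h1 h2 h3 h4]]]] : covered W e b.
  apply: (le_trans h4); rewrite lerD2l.
  have [tI len] := covered_length oW (fun i ni => let: And3 _ h _ := h1 i ni in h) h2 h3.
  apply: (acd n (fun i => u i) (fun i => v i)); [by move=> i; exact: h1|exact: tI|].
  by rewrite -lte_fin (le_lt_trans len).
(* Around each [s] coverage passes from the left to the right: at a point of [N] the interval []z,
   v[] is appended to the list, elsewhere the slope bound applies. *)
have step s : a <= s <= b -> exists2 r, 0 < r & forall z v, a <= z <= s ->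
    s <= v <= b -> s - r < z -> v < s + r -> covered W e z -> covered W e v.
  move=> sab; have [Ns|Ns] := pselect (N s).
    have /nbhs_ballP[r /= r0 rW] : nbhs s W by apply: open_nbhs_nbhs; split => //; exact: NW.
    exists r => // z v /andP[az zs] /andP[sv vb] rz vr [n [u [w [h1 h2 h3 h4]]]].
    exists n.+1, (fun i => if (i < n)%N then u i else z), (fun i => if (i < n)%N then w i else v).
    split.
    - move=> i _; case: ifPn => [/h1[? ? wz]|_].
        by split => //; rewrite (le_trans wz)// (le_trans zs sv).
      by split => //; rewrite (le_trans zs sv).
    - move=> i j /andP[ij]; rewrite ltnS => jn; rewrite (leq_trans ij jn).
      case: ifPn => [jn'|_]; first by apply: h2; rewrite ij.
      by have [_ _] := h1 i (leq_trans ij jn).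
    - move=> i _; case: ifPn => [/h3//|_] x; rewrite /= in_itv/= => /andP[zx xv].
      apply: rW; rewrite /ball/= ltr_distlC; apply/andP; split; lra.
    - rewrite big_ord_recr/= ltnn (eq_bigr (fun i : 'I_n => U (w i) - U (u i))) => [|i _]; last by rewrite ltn_ord.
      have : e * (z - a) <= e * (v - a) by rewrite ler_pM2l// lerD2r (le_trans zs).
      by move: h4; lra.
  have /(_ sab e e_gt0)[r r0 hr] : a <= s <= b ->
    forall e, 0 < e -> exists2 d : R, 0 < d &
      forall z v, a <= z <= s -> s <= v <= b -> s - d < z -> v < s + d ->
        U v - U z <= e * (v - z).
    by apply: contrapT => h; apply: Ns; apply: sN.
  exists r => // z v azs svb rz vr [n [u [w [h1 h2 h3 h4]]]].
  have zv : z <= v by move: azs svb => /andP[_ zs] /andP[sv _]; exact: le_trans sv.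
  exists n, u, w; split => // [i /h1[? ? wz]|]; first by split => //; exact: le_trans zv.
  by have := hr z v azs svb rz vr; move: h4; nra.
(* By [step], coverage extends beyond the supremum of the covered points unless [b] is reached. *)
pose S := [set s | a <= s <= b /\ covered W e s].
have Sa : S a.
  split; first by rewrite lexx.
  exists 0%N, (fun=> 0), (fun=> 0); split => //.
  by rewrite big_ord0 !subrr mulr0 addr0.
have supS : has_sup S by split; [exists a|exists b => s [/andP[]]].
have Sub : a <= sup S <= b.
  apply/andP; split; first by apply: ub_le_sup => //; exact: supS.2.
  by apply: ge_sup; [exists a|move=> s [/andP[]]].
have [r r0 hr] := step _ Sub.
have [z [azb Cz] rz] := sup_adherent r0 supS.
have zS : z <= sup S by apply: ub_le_sup => //; exact: supS.2.
have aS : a <= sup S by case/andP: Sub.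
pose v := Num.min b (sup S + r / 2).
have Cv : covered W e v.
  apply: (hr z) => //; rewrite /v.
  - by case/andP: azb => -> _.
  - by rewrite le_min ge_min lexx andbT; case/andP: Sub => _ ->/=; rewrite lerDl divr_ge0// ltW.
  - by rewrite gt_min; apply/orP; right; rewrite ltrD2l ltr_pdivrMr// ltr_pMr// ltr1n.
have : v <= sup S.
  apply: ub_le_sup; first exact: supS.2.
  split => //; rewrite /v le_min ge_min lexx ab andbT/=.
  by rewrite (le_trans aS)// lerDl divr_ge0// ltW.
rewrite /v ge_min => /orP[bS|]; last by rewrite gerDl leNgt divr_gt0.
by move: Cv; rewrite /v min_l// (le_trans bS)// lerDl divr_ge0// ltW.
Qed.

End AbsolutelyContinuousMonotone.

(** * Decay along solutions *)

(** The estimates on the two sides of [s] add up with the same [e], because [v - s] and [s - z] add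
    up to [v - z]. *)
Lemma derivable_straddle (R : realType) (V : normedModType R) (w : R -> V) (s : R) :
  derivable w s 1 -> forall e, 0 < e -> exists2 d : R, 0 < d &
    forall z v, z <= s -> s <= v -> s - d < z -> v < s + d ->
      `|w v - w z - (v - z) *: derive1 w s| <= e * (v - z).
Proof.
rewrite derive1E => dw e e0.
have /cvgrPdist_lt/(_ _ e0)[d /= d0 hd] :
  (fun h : R => h^-1 *: (w (h *: 1 + s) - w s)) @ 0^' --> 'D_1 w s by exact: dw.
have side h : `|h| < d -> `|w (s + h) - w s - h *: 'D_1 w s| <= e * `|h|.
  have [->|h0] := eqVneq h 0.
    by rewrite addr0 subrr scale0r subrr !normr0 mulr0.
  move=> hd'; have := hd h; rewrite /ball_ /= sub0r normrN => /(_ hd' h0)/ltW.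
  rewrite (_ : h *: 1 = h); last exact: mulr1.
  rewrite distrC [h + s]addrC => hh.
  have -> : w (s + h) - w s - h *: 'D_1 w s =
      h *: (h^-1 *: (w (s + h) - w s) - 'D_1 w s).
    by rewrite scalerBr scalerA divff// scale1r.
  by rewrite normrZ mulrC ler_pM2r ?normr_gt0.
exists d => // z v zs sv dz dv.
have h1 := side (v - s); have h2 := side (z - s).
rewrite [s + _]addrC subrK in h1; rewrite [s + _]addrC subrK in h2.
have {}h1 : `|w v - w s - (v - s) *: 'D_1 w s| <= e * (v - s).
  by rewrite -[X in e * X]ger0_norm ?subr_ge0//; apply: h1; rewrite ger0_norm ?subr_ge0//; lra.
have {}h2 : `|w z - w s - (z - s) *: 'D_1 w s| <= e * (s - z).
  rewrite -[X in e * X]ger0_norm ?subr_ge0// [`|s - z|]distrC; apply: h2.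
  by rewrite distrC ger0_norm ?subr_ge0//; lra.
have -> : w v - w z - (v - z) *: 'D_1 w s = w v - w s - (v - s) *: 'D_1 w s -
    (w z - w s - (z - s) *: 'D_1 w s).
  have E (a1 a2 a3 a4 : V) : a1 - a2 - (a3 - a4) = a1 - a3 - (a2 - a4).
    by rewrite opprD addrACA -opprD.
  rewrite E -scalerBl (_ : v - s - (z - s) = v - z); last by ring.
  by congr (_ - _); rewrite opprB addrA subrK.
apply: (le_trans (ler_normB _ _)); lra.
Qed.

Section Decay.
Variables (R : realType) (p q : nat) (A : 'M[R]_(p.+1, q.+1)).
Variables (rho : 'rV[R]_p.+1 -> R) (K : R) (beta : R^nat).
Hypothesis rho_good : good_perturbation rho.
Hypothesis rhoK : forall x, simplex_int x -> rho x <= K.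
Hypothesis beta_gt0 : forall n, 0 < beta n.
Local Notation state := ('rV[R]_p.+1 * 'rV[R]_q.+1 * R)%type.
Variable z : 'rV[R]_p.+1.
Hypothesis zI : simplex_int z.

Let th n := (beta n)^-1.
Let S := slice z finset.set0.
Let val n y := value A rho K th n y S.
Let b n y := maximizer A rho K th n y S.

Let th_gt0 n : 0 < th n. Proof. by rewrite invr_gt0. Qed.

Let SM : maximizable A rho K th S.
Proof. exact: slice_maximizable. Qed.

(** The normalization by [K] shifts the objective by a constant, so [xget] chooses from the same set
    on both sides. *)
Lemma br_maximizer n y : br A rho y (beta n) = b n y.
Proof.
rewrite /br /b /maximizer; congr xget; apply/seteqP; split=> x /=.
  move=> [xI xM]; split; first by split => // i; rewrite inE.
  by move=> x' /slice_int/xM; rewrite -/(th n) !mulrBr; lra.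
move=> [[xI _] xM]; split => // x' x'I.
have := xM x' (conj x'I _); rewrite -/(th n) !mulrBr => h.
by have := h (fun i => ltac:(by rewrite inE)); lra.
Qed.

Lemma maximizer_simplex n y : simplex (b n y).
Proof. by have [mS _] := maximizerP n y SM; exact: simplex_intW (slice_int mS). Qed.

Lemma value_lipschitz n y y' : val n y' - val n y <= payoff_bound A * `|y' - y|.
Proof.
apply: (le_trans (value_sub_le n y y' SM)); apply: (le_trans (ler_norm _)).
by apply: payoff_norm_simplexl; exact: maximizer_simplex.
Qed.

Lemma norm_state (w : state) : [/\ `|w.1.1| <= `|w|, `|w.1.2| <= `|w| & `|w.2| <= `|w|].
Proof. by case: w => -[x y] r /=; rewrite !prod_normE /= !le_max !lexx !orbT. Qed.

Variables (c eta : R) (B : nat -> 'rV[R]_q.+1 -> R).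
Hypothesis c0 : 0 < c.
Hypothesis B_corr : corrector A rho K th S c B.

Let F n y := val n y + B n y.

Lemma corrected_mono n k y : (n <= k)%N -> F k y <= F n y.
Proof.
have [B1 _ _] := B_corr.
have /nonincreasing_seqP h m : F m.+1 y <= F m y.
  by have := B1 m y; rewrite /F /val; lra.
by move=> nk; apply: (h n k).
Qed.

Let C := payoff_bound A + c.

Lemma corrected_lipschitz n y y' : F n y' - F n y <= C * `|y' - y|.
Proof.
have [_ B2 _] := B_corr; have := B2 n y y'; have := value_lipschitz n y y'.
by rewrite /F /C mulrDl; lra.
Qed.

Variables (t T : R) (w : R -> state).
Hypothesis t0 : 0 <= t.
Hypothesis w_sol : solution (smooth_br_incl A rho beta) (state_space A) t (t + T) w.
Hypothesis B_ub : forall n y, (clock t <= n)%N -> simplex y -> c + B n y <= eta.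

Let Z s := F (clock s) (w s).1.2 - (w s).2.
(** The exponential factor turns the slope bound [- (Z s - eta)] for [Z] into the slope bound
    [0]. *)
Let U s := expR s * (Z s - eta).
Let E := expR (t + T).
Let G := 2 * `|A|.

Let w_in s : t <= s <= t + T -> state_space A (w s).
Proof. by have [h _ _] := w_sol; exact: h. Qed.

Let Z_ub s : t <= s <= t + T -> Z s - eta <= G.
Proof.
move=> sT; have [_ yS /andP[pl _]] := w_in sT; have /andP[ts _] := sT.
have h1 := B_ub (clock_nondecreasing t0 ts) yS.
have h2 := value_le_best A rho_good rhoK th_gt0 zI (clock s) yS.
have h3 := le_trans (ler_norm _) (best_payoff_norm A yS).
by rewrite /Z /F /G /val; move: c0; lra.
Qed.

(** The clock can only lower [F], by [corrected_mono], so its jumps do not spoil an upper bound. *)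
Let Z_diff s v : t <= s -> s <= v -> Z v - Z s <= (C + 1) * `|w v - w s|.
Proof.
move=> ts sv; have cl := clock_nondecreasing (le_trans t0 ts) sv.
have h1 := corrected_mono (w s).1.2 cl.
have h2 := corrected_lipschitz (clock v) (w s).1.2 (w v).1.2.
have [_ n2 n3] := norm_state (w v - w s).
have h3 : - ((w v).2 - (w s).2) <= `|w v - w s|.
  by apply: le_trans n3; rewrite -normrN ler_norm.
have C0 : 0 <= C by rewrite addr_ge0 ?payoff_bound_ge0// ltW.
have h4 : C * `|(w v).1.2 - (w s).1.2| <= C * `|w v - w s| by rewrite ler_wpM2l.
by rewrite /Z mulrDl mul1r; lra.
Qed.

Let U_diff s v : t <= s -> s <= v -> v <= t + T ->
  U v - U s <= E * (C + 1) * `|w v - w s| + E * G * (v - s).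
Proof.
move=> ts sv vT.
have -> : U v - U s = expR v * (Z v - Z s) + (expR v - expR s) * (Z s - eta).
  by rewrite /U; ring.
have C1 : 0 <= C + 1 by rewrite !addr_ge0 ?payoff_bound_ge0// ltW.
have ev : expR v <= E by rewrite ler_expR.
have es : expR v - expR s <= E * (v - s).
  apply: (@le_trans _ _ (expR v * (v - s))); last by rewrite ler_wpM2r ?subr_ge0.
  have := expR_ge1Dx (s - v); rewrite -(ler_pM2l (expR_gt0 v)) -expRD [v + _]addrC subrK.
  by lra.
apply: lerD.
  apply: (@le_trans _ _ (expR v * ((C + 1) * `|w v - w s|))).
    by rewrite ler_pM2l ?expR_gt0// Z_diff.
  by rewrite -mulrA ler_wpM2r// mulr_ge0.
apply: (@le_trans _ _ ((expR v - expR s) * G)).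
  by rewrite ler_wpM2l ?subr_ge0 ?ler_expR// Z_ub// ts (le_trans sv).
by rewrite [leRHS]mulrAC ler_wpM2r// mulr_ge0.
Qed.

Let U_upper_ac e : 0 < e -> exists2 d : R, 0 < d &
  forall (n : nat) (u v : 'I_n -> R),
    (forall i, [/\ t <= u i, u i <= v i & v i <= t + T]) ->
    trivIset setT (fun i => `]u i, v i[%classic) ->
    \sum_i (v i - u i) < d -> \sum_i (U (v i) - U (u i)) <= e.
Proof.
move=> e0; have [_ ac _] := w_sol.
have C1 : 0 < C + 1 by rewrite ltr_wpDl// addr_ge0 ?payoff_bound_ge0// ltW.
have EC : 0 < E * (C + 1) by rewrite mulr_gt0 ?expR_gt0.
have EG : 0 < E * G + 1 by rewrite ltr_wpDl// !mulr_ge0// ltW// expR_gt0.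
have [d d0 hd] := ac (e / 2 / (E * (C + 1))) (divr_gt0 (divr_gt0 e0 (ltr0n R 2)) EC).
exists (Num.min d (e / 2 / (E * G + 1))); first by rewrite lt_min d0 !divr_gt0.
move=> n u v uv tI; rewrite lt_min => /andP[s1 s2].
have h1 := hd n u v uv tI s1.
apply: (@le_trans _ _ (\sum_i (E * (C + 1) * `|w (v i) - w (u i)| + E * G * (v i - u i)))).
  by apply: ler_sum => i _; have [? ? ?] := uv i; exact: U_diff.
rewrite big_split/= -!mulr_sumr.
move: h1; rewrite ltr_pdivlMr// mulrC => h1.
move: s2; rewrite ltr_pdivlMr// => s2.
have : 0 <= \sum_i (v i - u i).
  by apply: sumr_ge0 => i _; have [_ ? _] := uv i; rewrite subr_ge0.
lra.
Qed.

Let expR_sub_le (h : R) : 0 <= h -> h <= 1 / 2 -> `|expR h - 1 - h| <= 2 * h ^+ 2.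
Proof.
move=> h0 h1; have l := expR_ge1Dx h; have := expR_ge1Dx (- h).
have eh : 0 < expR h by exact: expR_gt0.
rewrite -(ler_pM2l eh) -expRD subrr expR0 => u.
rewrite ger0_norm; last by lra.
have : expR h * (1 - h) <= (1 + h + 2 * h ^+ 2) * (1 - h).
  apply: (@le_trans _ _ 1); first by lra.
  by rewrite expr2; nra.
by rewrite ler_pM2r; lra.
Qed.

Ltac clear_local := repeat match goal with
  H : is_true _ |- _ =>
    tryif first [constr_eq H c0 | constr_eq H t0] then fail else clear H
  end.

(* At a point s where the inclusion holds the slope is at most c + B - eta <= 0 plus
   th (rho - K) <= 0: the payoffs against the control tau cancel. *)
Let U_slope s : t <= s <= t + T ->
  derivable w s 1 /\ smooth_br_incl A rho beta s (w s) (derive1 w s) ->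
  forall e, 0 < e -> exists2 d : R, 0 < d &
    forall u v, t <= u <= s -> s <= v <= t + T -> s - d < u -> v < s + d ->
      U v - U u <= e * (v - u).
Proof.
move=> sT [dw [tau tauS dwE]] e e0; have /andP[ts _] := sT.
have [xS yS _] := w_in sT; set n := clock s in dwE.
rewrite br_maximizer in dwE.
set y := (w s).1.2 in yS dwE; set m := b n y in dwE.
pose PB := payoff_bound A; have PB0 : 0 <= PB by exact: payoff_bound_ge0.
have [L L0 lip] := maximizer_lipschitz A K rho_good th_gt0 n finset.set0 zI.
have [d1 d10 cl] := clock_right_constant (le_trans t0 ts).
have E0 : 0 < E by exact: expR_gt0.
(* [C3] dominates the coefficients of the errors of order [e1 * h]; [e1] is chosen for these to use
   half of [e], and [d4] keeps the second-order error of the exponential within the other half. *)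
pose C3 := PB + 2 * PB + 3 * c + C + 3.
have C0 : 0 <= C by rewrite addr_ge0// ltW.
have C30 : 0 < C3 by rewrite /C3; move: PB0 C0 c0; clear_local; lra.
pose e1 := Num.min 1 (e / 2 / (E * C3)).
have e10 : 0 < e1 by rewrite lt_min ltr01 !divr_gt0// mulr_gt0.
have e11 : e1 <= 1 by rewrite ge_min lexx.
have e1e : E * (e1 * C3) <= e / 2.
  by rewrite mulrCA -ler_pdivlMr ?mulr_gt0// ge_min lexx orbT.
have [d2 d20 strad] := derivable_straddle dw e10.
have [d3 d30 cont] : exists2 d : R, 0 < d &
    forall v, `|v - s| < d -> `|w v - w s| <= e1 / (L + 1).
  have e1L : 0 < e1 / (L + 1) by rewrite divr_gt0// ltr_wpDl.
  have wc : {for s, continuous w}.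
    by apply/differentiable_continuous/derivable1_diffP.
  move/cvgrPdist_le : wc => /(_ _ e1L) /nbhs_ballP[d /= d0 hd].
  exists d => // v vs; rewrite distrC; apply: hd.
  by rewrite /ball/= distrC.
pose Y0 := `|Z s - eta| + C + 1.
have Y00 : 0 < Y0 by rewrite /Y0 ltr_wpDl// addr_ge0.
pose d4 := e / 2 / (E * (4 * Y0)).
have d40 : 0 < d4 by rewrite !divr_gt0// !mulr_gt0.
exists (Num.min (Num.min d1 d2) (Num.min d3 (Num.min d4 (1 / 4)))).
  by rewrite !lt_min d10 d20 d30 d40; lra.
move=> u v /andP[tu us] /andP[sv vT]; set D := Num.min _ _ => uD vD.
have [D1 D2 D3 D4 D5] : [/\ D <= d1, D <= d2, D <= d3, D <= d4 & D <= 1 / 4].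
  by split; rewrite /D !ge_min lexx ?orbT.
have uT : t <= u <= t + T by rewrite tu (le_trans us)// (le_trans sv).
have vT' : t <= v <= t + T by rewrite vT (le_trans ts).
have clv : clock v = n by apply: cl => //; move: vD D1; clear_local; lra.
pose h := v - u; have h0 : 0 <= h by rewrite subr_ge0 (le_trans us).
pose yv := (w v).1.2; pose yu := (w u).1.2.
have /= st := strad u v us sv _ _; have {}st : `|w v - w u - h *: derive1 w s| <= e1 * h.
  by apply: st; move: uD vD D2; clear_local; lra.
have [_ st2 st3] := norm_state (w v - w u - h *: derive1 w s).
have {st3}st3 := le_trans st3 st; have {st2}st2 := le_trans st2 st.
rewrite -dwE /= -/yv -/yu in st2; rewrite -dwE /= in st3.
have wv : `|w v - w s| <= e1 / (L + 1).
  by apply: cont; rewrite ger0_norm ?subr_ge0//; move: vD D3; clear_local; lra.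
have wv1 : `|w v - w s| <= e1.
  by apply: le_trans wv _; rewrite ler_pdivrMr ?ltr_wpDl// ler_peMr ?(ltW e10)// lerDr.
have [_ wv2 wv3] := norm_state (w v - w s).
rewrite /= -/yv -/y in wv2; rewrite /= in wv3.
pose mv := b n yv.
have mvm : `|mv - m| <= e1.
  apply: (le_trans (lip _ _)); apply: (@le_trans _ _ (L * (e1 / (L + 1)))).
    by rewrite ler_wpM2l// (le_trans wv2).
  rewrite mulrCA ger_pMr// ler_pdivrMr ?ltr_wpDl// mul1r lerDl//.
have ty : `|tau - y| <= 1 by exact: simplex_dist.
have dy : `|yv - yu| <= 2 * h.
  rewrite -[yv - yu](subrK (h *: (tau - y))).
  apply: (le_trans (ler_normD _ _)); rewrite normrZ (ger0_norm h0).
  have : h * `|tau - y| <= h by rewrite ler_piMr.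
  have : e1 * h <= h by rewrite ler_piMl.
  by move: st2; clear_local; lra.
have dy' : `|yv - yu| <= (1 + e1) * h.
  rewrite -[yv - yu](subrK (h *: (tau - y))).
  apply: (le_trans (ler_normD _ _)); rewrite normrZ (ger0_norm h0).
  have : h * `|tau - y| <= h by rewrite ler_piMr.
  by move: st2; clear_local; lra.
(* The maximizer at [v] is replaced by [m] and the increment of the second coordinate by
   [h *: (tau - y)], with errors of order [e1 * h]. *)
have X1 : payoff A mv (yv - yu) <= h * payoff A m (tau - y) + 3 * PB * e1 * h.
  have -> : payoff A mv (yv - yu) = payoff A (mv - m) (yv - yu) +
      payoff A m (yv - yu - h *: (tau - y)) + h * payoff A m (tau - y).
    by rewrite payoffBl (payoffBr A m (yv - yu)) payoffZr; ring.
  have a1 : payoff A (mv - m) (yv - yu) <= PB * e1 * (2 * h).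
    apply: (le_trans (ler_norm _)); apply: (le_trans (payoff_norm _ _ _)).
    by apply: ler_pM; rewrite ?mulr_ge0// ler_wpM2l.
  have a2 : payoff A m (yv - yu - h *: (tau - y)) <= PB * (e1 * h).
    apply: (le_trans (ler_norm _)).
    apply: (le_trans (payoff_norm_simplexl _ _ (maximizer_simplex n y))).
    by rewrite ler_wpM2l.
  by move: a1 a2; clear_local; lra.
have mS := maximizer_simplex n y.
have Fv : F n yv - F n yu <= payoff A mv (yv - yu) + c * `|yv - yu|.
  have [_ B2 _] := B_corr; have := B2 n yu yv; have := value_sub_le n yu yv SM.
  by rewrite /F /val -/(b n yv) -/mv; clear_local; lra.
(* Left of [s] the clock may still be below [n]; [F] is larger there, so the jump has the favourable
   sign. *)
have Fu : F n yu <= F (clock u) yu.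
  by apply: corrected_mono; apply: clock_nondecreasing => //; exact: le_trans tu.
(* [payoff A m tau] enters the variation of [F] and that of the third coordinate with opposite
   signs, so [tau] disappears. *)
have Zvu : Z v - Z u <= h * (c - payoff A m y + (w s).2 + e1 * (3 * PB + c + 1)).
  have a1 : c * `|yv - yu| <= c * ((1 + e1) * h) by rewrite ler_pM2l.
  have a2 : - ((w v).2 - (w u).2) <= - (h * (payoff A m tau - (w s).2)) + e1 * h.
    by move: st3; rewrite ler_norml => /andP[+ _]; rewrite -[h *: _]/(h * _); clear_local; lra.
  move: X1; rewrite (payoffBr A m tau y); by move: Fv Fu a1 a2; rewrite /Z clv -/yv -/yu; clear_local; lra.
(* The value is at most the payoff of its maximizer, and [eta] absorbs [c] and the corrector; the
   main term of [Zvu] is thus at most [- h * (Z s - eta)]. *)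
have ZsE : Z s - eta <= payoff A m y - (w s).2 - c.
  have := B_ub (clock_nondecreasing t0 ts) yS.
  have := value_le_payoff A rho_good rhoK th_gt0 zI n y.
  by rewrite /Z /F /val -/n -/y -/(b n y) -/m; clear_local; lra.
have Zvs : Z v - Z s <= (C + 1) * e1.
  by apply: le_trans (Z_diff ts sv) _; rewrite ler_wpM2l// addr_ge0.
have Zsv : Z s - Z v <= (C + 1) * e1.
  rewrite /Z clv -/n -/yv -/y.
  have a1 := corrected_lipschitz n yv y; rewrite distrC in a1.
  have a2 : C * `|yv - y| <= C * e1 by rewrite ler_wpM2l// (le_trans wv2).
  have a3 : (w v).2 - (w s).2 <= e1.
    exact: le_trans (ler_norm _) (le_trans wv3 wv1).
  by move: a1 a2 a3; clear_local; lra.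
have absY : `|Z v - eta| <= Y0.
  rewrite -[Z v - eta](subrKA (Z s)); apply: (le_trans (ler_normD _ _)).
  have : `|Z v - Z s| <= C + 1.
    have : (C + 1) * e1 <= C + 1 by rewrite ler_piMr// addr_ge0.
    by move=> h'; rewrite ler_norml; apply/andP; move: h' Zvs Zsv; clear_local; split; lra.
  by rewrite /Y0; clear_local; lra.
have -> : U v - U u = expR u * ((Z v - Z u) + (expR h - 1) * (Z v - eta)).
  have -> : U v = expR u * expR h * (Z v - eta) by rewrite -expRD /h [u + _]addrC subrK.
  by rewrite /U; ring.
have main : (Z v - Z u) + (expR h - 1) * (Z v - eta) <= h * (e / E).
  have hh : h <= 1 / 2 by rewrite /h; move: uD vD D5; clear_local; lra.
  have er := expR_sub_le h0 hh.
  have a1 : (expR h - 1 - h) * (Z v - eta) <= 2 * h ^+ 2 * Y0.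
    by apply: (le_trans (ler_norm _)); rewrite normrM ler_pM.
  have a2 : 2 * h ^+ 2 * Y0 <= h * (e / 2 / E).
    have h4 : h <= 2 * d4 by rewrite /h; move: uD vD D4; clear_local; lra.
    rewrite expr2 (_ : 2 * (h * h) * Y0 = h * (2 * Y0 * h)); last by ring.
    rewrite ler_wpM2l//; apply: (@le_trans _ _ (2 * Y0 * (2 * d4))).
      by rewrite ler_wpM2l// mulr_ge0// ltW.
    rewrite /d4 le_eqVlt; apply/orP; left; apply/eqP; field.
    by rewrite !gt_eqF.
  have a3 : e1 * (3 * PB + c + 1) + (C + 1) * e1 <= e / 2 / E.
    rewrite ler_pdivlMr// mulrC; apply: le_trans e1e; rewrite ler_pM2l//.
    rewrite [_ * e1]mulrC -mulrDr ler_pM2l// /C3; move: PB0 c0; clear_local; lra.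
  have a4 : h * (c - payoff A m y + (w s).2 + e1 * (3 * PB + c + 1) + (Z v - eta)) <=
      h * (e / 2 / E).
    by rewrite ler_wpM2l//; move: a3 ZsE Zvs; clear_local; lra.
  have -> : h * (e / E) = h * (e / 2 / E) + h * (e / 2 / E) by field; rewrite gt_eqF.
  by move: Zvu a1 a2 a4; clear_local; lra.
apply: (@le_trans _ _ (expR u * (h * (e / E)))); first by rewrite ler_pM2l ?expR_gt0.
have -> : e * (v - u) = E * (h * (e / E)) by rewrite /h; field; rewrite gt_eqF.
have hE : 0 <= h * (e / E) by rewrite mulr_ge0// divr_ge0// ltW.
by apply: ler_wpM2r => //; rewrite /E ler_expR; case/andP: uT.
Qed.

Lemma corrected_decay s : 0 < s <= T ->
  Z (t + s) - eta <= expR (- s) * (Z t - eta).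
Proof.
move=> /andP[s0 sT].
have le1 : t <= t + s by rewrite lerDl ltW.
have le2 : t + s <= t + T by rewrite lerD2l.
have := @upper_ac_nonincreasing R U t (t + s) le1.
have hac : forall e, 0 < e -> exists2 d : R, 0 < d &
    forall (n : nat) (u v : 'I_n -> R),
      (forall i, [/\ t <= u i, u i <= v i & v i <= t + s]) ->
      trivIset setT (fun i => `]u i, v i[%classic) ->
      \sum_i (v i - u i) < d -> \sum_i (U (v i) - U (u i)) <= e.
  move=> e /U_upper_ac[d d0 hd]; exists d => // n u v uv; apply: hd => i.
  by have [? ? h] := uv i; split => //; exact: le_trans le2.
move=> /(_ hac) {hac}; have hsl : \forall r \ae (@lebesgue_measure R), t <= r <= t + s ->
    forall e, 0 < e -> exists2 d : R, 0 < d &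
      forall u v, t <= u <= r -> r <= v <= t + s -> r - d < u -> v < r + d ->
        U v - U u <= e * (v - u).
  have [_ _ [N [mN N0 sN]]] := w_sol; exists N; split => // r Nr; apply: sN => hr.
  apply: Nr => /andP[tr rs] e e0.
  have rT : t <= r <= t + T by rewrite tr (le_trans rs).
  have [d d0 hd] := U_slope rT (hr rT) e0.
  exists d => // u v tur /andP[rv vs]; apply: hd => //.
  by rewrite rv (le_trans vs).
move=> /(_ hsl); rewrite /U expRD -mulrA ler_pM2l ?expR_gt0// => h.
by rewrite -(ler_pM2l (expR_gt0 s)) mulrA -expRD subrr expR0 mul1r.
Qed.

End Decay.

(** * Closure properties of C^k functions *)

Section CkClosure.
Variables (R : realType) (V : normedModType R) (U : set V).
Hypothesis oU : open U.
Implicit Types (f g : V -> R) (h x : V) (k : nat).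

Lemma continuous_within_openP f :
  {within U, continuous f} <-> forall x, U x -> {for x, continuous f}.
Proof.
rewrite continuous_open_subspace//; split=> c x; first by move=> Ux; apply: c; rewrite inE.
by rewrite inE => Ux; exact: c.
Qed.

Lemma near_open (P : set V) x : U x -> (forall z, U z -> P z) -> \near x, P x.
Proof.
move=> Ux UP; have : nbhs x U by apply: open_nbhs_nbhs.
by apply: filterS.
Qed.

Lemma Ck_along_eq k f g : (forall x, U x -> f x = g x) ->
  Ck_along setT U k f -> Ck_along setT U k g.
Proof.
elim: k f g => [|k IH] f g fg [cf df]; (split;
    first by apply: subspace_eq_continuous cf => x; rewrite inE; exact: fg) => //.
move=> h hT; have [d1 d2] := df h hT.
have nfg x : U x -> \near x, f x = g x by move=> Ux; apply: near_open.
split; first by move=> x Ux; apply: near_eq_derivable (d1 x Ux); exact: nfg.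
by apply: IH d2 => x Ux; apply: near_eq_derive; exact: nfg.
Qed.

Lemma Ck_along0 k f : Ck_along setT U k f -> {within U, continuous f}.
Proof. by case: k => [|k] []. Qed.

Lemma Ck_alongW k f : Ck_along setT U k.+1 f -> Ck_along setT U k f.
Proof.
elim: k f => [|k IH] f [cf df]; split => // h hT.
by have [d1 d2] := df h hT; split => //; exact: IH.
Qed.

Lemma Ck_along_cst k (c : R) : Ck_along setT U k (cst c).
Proof.
elim: k c => [|k IH] c; (split;
  first by apply/continuous_within_openP => x _; exact: cst_continuous) => //.
move=> h _; split; first by move=> x _; exact: derivable_cst.
by apply: Ck_along_eq (IH 0) => x _; rewrite derive_cst.
Qed.

Lemma Ck_alongD k f g : Ck_along setT U k f -> Ck_along setT U k g ->
  Ck_along setT U k (fun x => f x + g x).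
Proof.
elim: k f g => [|k IH] f g Cf Cg; (split;
    first by (move: (Ck_along0 Cf) (Ck_along0 Cg) => /continuous_within_openP cf
      /continuous_within_openP cg; apply/continuous_within_openP => x Ux;
      apply: cvgD; [exact: cf|exact: cg])) => //.
move=> h hT; have [d1 d2] := Cf.2 h hT; have [e1 e2] := Cg.2 h hT.
split; first by move=> x Ux; apply: derivableD; [exact: d1|exact: e1].
by apply: Ck_along_eq (IH _ _ d2 e2) => x Ux; rewrite deriveD//; [exact: d1|exact: e1].
Qed.

Lemma Ck_alongM k f g : Ck_along setT U k f -> Ck_along setT U k g ->
  Ck_along setT U k (fun x => f x * g x).
Proof.
elim: k f g => [|k IH] f g Cf Cg; (split;
    first by (move: (Ck_along0 Cf) (Ck_along0 Cg) => /continuous_within_openP cf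
      /continuous_within_openP cg; apply/continuous_within_openP => x Ux;
      apply: cvgM; [exact: cf|exact: cg])) => //.
move=> h hT; have [d1 d2] := Cf.2 h hT; have [e1 e2] := Cg.2 h hT.
split; first by move=> x Ux; apply: derivableM; [exact: d1|exact: e1].
apply: Ck_along_eq (Ck_alongD (IH _ _ (Ck_alongW Cf) e2) (IH _ _ (Ck_alongW Cg) d2)) => x Ux.
by rewrite deriveM//; [exact: d1|exact: e1].
Qed.

Lemma Ck_alongN k f : Ck_along setT U k f -> Ck_along setT U k (fun x => - f x).
Proof.
move=> Cf; apply: Ck_along_eq (Ck_alongM (Ck_along_cst k (-1)) Cf) => x _.
by rewrite /cst mulN1r.
Qed.

Lemma Ck_along_sum k (I : Type) (s : seq I) (F : I -> V -> R) :
  (forall i, Ck_along setT U k (F i)) -> Ck_along setT U k (fun x => \sum_(i <- s) F i x).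
Proof.
move=> CF; elim: s => [|i s IH].
  by apply: Ck_along_eq (Ck_along_cst k 0) => x _; rewrite big_nil.
by apply: Ck_along_eq (Ck_alongD (CF i) IH) => x _; rewrite big_cons.
Qed.

(** A linear function has constant directional derivatives, which settles all orders at once; the
    bound by [C] gives continuity. *)
Lemma Ck_along_linear k f (C : R) : (forall x, `|f x| <= C * `|x|) ->
  (forall (t : R) h x, f (t *: h + x) = t * f h + f x) -> Ck_along setT U k f.
Proof.
move=> fC lf; have cfU : {within U, continuous f}.
  apply: continuous_subspaceT => x; apply/cvgrPdist_lt => e e0.
  have C1 : 0 < `|C| + 1 by rewrite ltr_wpDl.
  apply/nbhs_normP; exists (e / (`|C| + 1)) => [|z /=]; first by rewrite /= divr_gt0.
  rewrite ltr_pdivlMr// mulrC => xz.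
  have -> : f x - f z = f (x - z) by rewrite (_ : x - z = -1 *: z + x) ?lf ?mulN1r 1?addrC// scaleN1r addrC.
  apply: le_lt_trans (fC _) _; apply: le_lt_trans xz; apply: ler_wpM2r => //.
  by apply: (le_trans (ler_norm _)); rewrite lerDl.
case: k => [//|k]; split => // h _.
have df x : (fun t : R => t^-1 *: ((f \o shift x) (t *: h) - f x)) @ 0^' --> f h.
  apply: cvg_near_cst; near=> t.
  have t0 : t != 0 by near: t; exact: nbhs_dnbhs_neq.
  rewrite /=.
  by rewrite lf addrK -[_ *: _]/(_ * _) mulKf.
split; first by move=> x _; apply/cvg_ex; exists (f h).
by apply: Ck_along_eq (Ck_along_cst k (f h)) => x _; apply/esym/cvg_lim.
Unshelve. all: by end_near. Qed.

(** Restriction to the line through [x] along [h] reduces this to the chain rule in one variable. *)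
Lemma is_derive_comp (G : R -> R) f x h (dG : R) :
  derivable f x h -> is_derive (f x) 1 G dG ->
  is_derive x h (fun z => G (f z)) (dG * 'D_h f x).
Proof.
move=> df [exG DG].
have E (g : V -> R) : 'D_h g x = derive1 (fun t : R => g (t *: h + x)) 0.
  rewrite derive1E /derive.
  rewrite (_ : (fun t : R => t^-1 *: ((g \o shift x) (t *: h) - g x)) =
    (fun t : R => t^-1 *: (((fun t : R => g (t *: h + x)) \o shift 0) (t *: 1) -
      g (0 *: h + x))))//.
  by apply/funext => t /=; rewrite addr0 scale0r add0r (_ : t *: 1 = t)//; exact: mulr1.
have df1 := (derivable1P _ _ _).1 df.
have fx : (fun t : R => f (t *: h + x)) 0 = f x by rewrite scale0r add0r.
have exG' : derivable G ((fun t : R => f (t *: h + x)) 0) 1 by rewrite fx.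
split.
  apply/derivable1P/derivable1_diffP.
  by apply: (@differentiable_comp _ _ _ _ (fun t : R => f (t *: h + x)) G);
    apply/derivable1_diffP.
rewrite !E (@derive1_comp _ (fun t : R => f (t *: h + x)) G)//.
by rewrite fx derive1E DG.
Qed.

Lemma Ck_along_exp k f : Ck_along setT U k f -> Ck_along setT U k (fun x => expR (f x)).
Proof.
elim: k f => [|k IH] f Cf; (split; first by
    (move: (Ck_along0 Cf) => /continuous_within_openP cf; apply/continuous_within_openP => x Ux;
    apply: (@continuous_comp _ _ _ f (@expR R)); [exact: cf|exact: continuous_expR])) => //.
move=> h hT; have [d1 d2] := Cf.2 h hT.
have D x : U x -> is_derive x h (fun x => expR (f x)) (expR (f x) * 'D_h f x).
  by move=> Ux; apply: is_derive_comp; exact: d1.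
split; first by move=> x /D[].
by apply: Ck_along_eq (Ck_alongM (IH _ (Ck_alongW Cf)) d2) => x /D[].
Qed.

(* The derivative of ln (f x) involves (f x)^-1 = expR (- ln (f x)). *)
Lemma Ck_along_ln k f : (forall x, U x -> 0 < f x) ->
  Ck_along setT U k f -> Ck_along setT U k (fun x => ln (f x)).
Proof.
move=> f0; elim: k => [|k IH] Cf; (split; first by
    (move: (Ck_along0 Cf) => /continuous_within_openP cf; apply/continuous_within_openP => x Ux;
    apply: (@continuous_comp _ _ _ f (@ln R)); [exact: cf|apply: continuous_ln; exact: f0])) => //.
move=> h hT; have [d1 d2] := Cf.2 h hT.
have D x : U x -> is_derive x h (fun x => ln (f x)) ((f x)^-1 * 'D_h f x).
  by move=> Ux; apply: is_derive_comp; [exact: d1|apply: is_derive1_ln; exact: f0].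
split; first by move=> x /D[].
apply: Ck_along_eq (Ck_alongM (Ck_along_exp (Ck_alongN (IH (Ck_alongW Cf)))) d2) => x Ux.
by have [_ ->] := D x Ux; rewrite expRN lnK// posrE f0.
Qed.

Lemma Ck_alongV k f : (forall x, U x -> 0 < f x) ->
  Ck_along setT U k f -> Ck_along setT U k (fun x => (f x)^-1).
Proof.
move=> f0 Cf; apply: Ck_along_eq (Ck_along_exp (Ck_alongN (Ck_along_ln f0 Cf))) => x Ux.
by rewrite expRN lnK// posrE f0.
Qed.

End CkClosure.

(** * The Lyapunov function *)

Section Lyapunov.
Variables (R : realType) (p q : nat) (A : 'M[R]_(p.+1, q.+1)).
Local Notation state := ('rV[R]_p.+1 * 'rV[R]_q.+1 * R)%type.
Implicit Types w : state.

Definition gap w : R := best_payoff A w.1.2 - w.2.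

(** The summand [1] is the exponential of [0]: the soft maximum runs over [0] and the [p.+1] pure
    actions, hence the [p.+2] in the error and the positive part of the gap in the limit. *)
Definition smooth_gap (tw : R * state) : R :=
  (tw.1 + 1)^-1 * ln (1 + \sum_i expR ((tw.1 + 1) *
    (payoff A (delta_mx 0 i) tw.2.1.2 - tw.2.2))).

Definition smooth_gap_error (t : R) : R := (t + 1)^-1 * ln p.+2%:R.

Let sum_gt0 (t : R) w :
  0 < 1 + \sum_i expR ((t + 1) * (payoff A (delta_mx 0 i) w.1.2 - w.2)).
Proof. by rewrite ltr_pwDl// sumr_ge0// => i _; exact: expR_ge0. Qed.

Lemma smooth_gap_ge0 t w : 0 <= t -> 0 <= smooth_gap (t, w).
Proof.
move=> t0; rewrite mulr_ge0 ?invr_ge0 ?addr_ge0// ln_ge0//= lerDl.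
by apply: sumr_ge0 => i _; exact: expR_ge0.
Qed.

Lemma gap_le_smooth t w : 0 <= t -> gap w <= smooth_gap (t, w).
Proof.
move=> t0; have t1 : 0 < t + 1 by rewrite ltr_wpDl.
rewrite /gap lerBlDr; apply: best_payoff_le => i.
rewrite -lerBlDr /smooth_gap/= [leRHS]mulrC ler_pdivlMr// mulrC.
rewrite -ler_expR lnK ?posrE//; set a := expR _.
by rewrite (bigD1 i)//= -/a addrCA lerDl addr_ge0// sumr_ge0.
Qed.

Lemma smooth_gap_le t w : 0 <= t ->
  smooth_gap (t, w) <= Num.max (gap w) 0 + smooth_gap_error t.
Proof.
move=> t0; have t1 : 0 < t + 1 by rewrite ltr_wpDl.
set V := Num.max _ _; have V0 : 0 <= V by rewrite le_max lexx orbT.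
rewrite /smooth_gap/= /smooth_gap_error.
have -> : V = (t + 1)^-1 * ((t + 1) * V) by rewrite mulrA mulVf ?mul1r// lt0r_neq0.
rewrite -mulrDr ler_pM2l ?invr_gt0//.
rewrite -ler_expR lnK ?posrE// expRD lnK ?posrE ?ltr0n//.
rewrite mulr_natr mulrS; apply: lerD; first by apply: le_trans (expR_ge1Dx _); rewrite lerDl mulr_ge0// ltW.
rewrite -[X in _ *+ X]card_ord -sumr_const; apply: ler_sum => i _.
rewrite ler_expR ler_pM2l// le_max; apply/orP; left.
by rewrite /gap lerD2r le_best_payoff.
Qed.

Lemma smooth_gap_errorS t : 0 <= t -> 0 <= smooth_gap_error t <= ln p.+2%:R.
Proof.
move=> t0; have l0 : 0 <= ln (p.+2%:R : R) by rewrite ln_ge0// ler1n.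
have t1 : 0 < t + 1 by rewrite ltr_wpDl.
by rewrite mulr_ge0 ?invr_ge0 ?(ltW t1)//= ler_piMl// invf_le1// lerDr.
Qed.

Lemma smooth_gap_smooth :
  smooth_on [set tw : R * state | 0 <= tw.1 /\ state_space A tw.2] smooth_gap.
Proof.
(* On this open neighbourhood [tw.1 + 1] stays positive, so the same formula is smooth there. *)
pose W : set (R * state) := [set tw | -1 < tw.1].
have oW : open W.
  apply: (@open_comp _ _ (fun tw : R * state => tw.1) [set t | -1 < t]); last exact: open_gt.
  by move=> tw _; exact: cvg_fst.
exists W, smooth_gap; split => //.
  by move=> tw [t0 _]; rewrite /W/=; apply: lt_le_trans t0; rewrite oppr_lt0.
move=> k.
have Ct : Ck_along setT W k (fun tw : R * state => tw.1 + 1).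
  apply: (Ck_alongD oW); last exact: Ck_along_cst.
  apply: (@Ck_along_linear _ _ _ oW _ _ 1) => [tw|//].
  by rewrite mul1r prod_normE le_max lexx.
have W0 tw : W tw -> 0 < tw.1 + 1 by rewrite /W/= => ?; lra.
apply: (Ck_alongM oW); first exact: (Ck_alongV oW).
apply: (Ck_along_ln oW) => [tw _|]; first exact: sum_gt0.
apply: (Ck_alongD oW); first exact: Ck_along_cst.
apply: (Ck_along_sum oW) => i; apply: (Ck_along_exp oW); apply: (Ck_alongM oW) => //.
apply: (@Ck_along_linear _ _ _ oW _ _ (payoff_bound A + 1)) => [[t w]|a [t w] [t' w']] /=.
  have [_ n2 n3] := norm_state w.
  have n4 : `|w| <= `|(t, w)| by rewrite prod_normE le_max lexx orbT.
  apply: (le_trans (ler_normB _ _)); rewrite mulrDl mul1r lerD//; last exact: le_trans n4.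
  apply: (le_trans (payoff_norm_simplexl _ _ (delta_simplex R i))).
  by rewrite ler_wpM2l ?payoff_bound_ge0// (le_trans n2).
by rewrite payoffDr payoffZr -[a *: w.2]/(a * w.2); ring.
Qed.

Lemma state_space_compact : compact (state_space A).
Proof.
have -> : state_space A = (@simplex R p `*` @simplex R q) `*` `[- `|A|, `|A|].
  apply/seteqP; split=> [[[x y] r] [/= xS yS rA]|[[x y] r] [[/= xS yS] rA]].
    by split=> //=; rewrite in_itv.
  by split=> //=; move: rA; rewrite in_itv.
by apply: compact_setX; [apply: compact_setX; exact: simplex_compact|exact: segment_compact].
Qed.

Lemma consistent_set_compact : compact (consistent_set A).
Proof.
have -> : consistent_set A = state_space A `&`
    \bigcap_i [set w : state | payoff A (delta_mx 0 i) w.1.2 - w.2 <= 0].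
  apply/seteqP; split=> w [wM wA]; split => //.
    by move=> i _ /=; apply: le_trans wA; rewrite lerD2r le_best_payoff.
  by rewrite subr_le0; apply: best_payoff_le => i; rewrite -subr_le0; exact: wA.
apply: compact_closedI; first exact: state_space_compact.
apply: closed_bigI => i _.
apply: (@closed_comp _ _ (fun w : state => payoff A (delta_mx 0 i) w.1.2 - w.2)
  [set r | r <= 0]); last exact: closed_le.
move=> w _.
have [+ _] : Ck_along setT setT 0 (fun w : state => payoff A (delta_mx 0 i) w.1.2 - w.2).
  apply: (@Ck_along_linear _ _ _ openT _ _ (payoff_bound A + 1)) => [{}w|a {}w w'] /=.
    have [_ n2 n3] := norm_state w.
    apply: (le_trans (ler_normB _ _)); rewrite mulrDl mul1r lerD//.
    apply: (le_trans (payoff_norm_simplexl _ _ (delta_simplex R i))).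
    by rewrite ler_wpM2l ?payoff_bound_ge0.
  by rewrite payoffDr payoffZr -[a *: w.2]/(a * w.2); ring.
by move=> /(continuous_within_openP openT); exact.
Qed.

Lemma gap_bound w : state_space A w -> Num.max (gap w) 0 <= 2 * `|A|.
Proof.
move=> [_ yS /andP[wA _]]; have := le_trans (ler_norm _) (best_payoff_norm A yS).
by move=> h; rewrite ge_max mulr_ge0// andbT /gap; lra.
Qed.

Variables (rho : 'rV[R]_p.+1 -> R) (beta : R^nat).
Hypothesis rho_good : good_perturbation rho.
Hypothesis beta_incr : nondecreasing_seq beta.
Hypothesis beta_gt0 : forall n, 0 < beta n.
Hypothesis beta_cvgy : beta @ \oo --> +oo.

Lemma gap_decay (e : R) : 0 < e -> exists2 t0 : R, 0 <= t0 &
  forall t T (w : R -> state), t0 <= t -> 0 < T ->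
  solution (smooth_br_incl A rho beta) (state_space A) t (t + T) w ->
  forall s, 0 < s <= T ->
    Num.max (gap (w (t + s))) 0 <= expR (- s) * Num.max (gap (w t)) 0 + e.
Proof.
move=> e0; have [K rhoK] := perturbation_ub rho_good.
pose th n := (beta n)^-1; pose z : 'rV[R]_p.+1 := const_mx p.+1%:R^-1.
have zI : simplex_int z by exact: barycenter_int.
have th_gt0 n : 0 < th n by rewrite invr_gt0.
have th_decr n : th n.+1 <= th n by rewrite lef_pV2 ?posrE// beta_incr.
have th0 d : 0 < d -> exists N, forall n, (N <= n)%N -> th n < d.
  move=> d0; move/cvgryPgt : beta_cvgy => /(_ d^-1)[N _ hN].
  by exists N => n /hN /= ?; rewrite /th invf_plt ?posrE.
(* The total error is [6 * c]: [3 * c] is the constant [eta] of [corrected_decay], and [3 * c]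
   bounds the gap minus [Z]. *)
pose c := e / 6; have c0 : 0 < c by rewrite divr_gt0.
have [B Bcor [N1 hN1]] :=
  normalized_corrector A rho_good rhoK th_gt0 th_decr th0 zI c0.
have [N2 hN2] := value_cvg_best A rho_good rhoK th_gt0 th0 zI c0.
have [t0 t0_ge0 ht0] := @clock_cvgy R (maxn N1 N2).
exists t0 => // t T w tt0 T0 wsol s /andP[s0 sT].
have tge0 : 0 <= t by exact: le_trans tt0.
have Bub n y : (clock t <= n)%N -> simplex y -> c + B n y <= 3 * c.
  move=> tn yS; have nN : (N1 <= n)%N.
    by apply: leq_trans tn; apply: leq_trans (ht0 t tt0); exact: leq_maxl.
  by have := hN1 n y nN yS; rewrite ler_norml => /andP[_]; lra.
have sT' : 0 < s <= T by rewrite s0.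
pose Z r := value A rho K th (clock r) (w r).1.2 (slice z finset.set0) +
  B (clock r) (w r).1.2 - (w r).2.
have dec : Z (t + s) - 3 * c <= expR (- s) * (Z t - 3 * c).
  by have := corrected_decay rho_good rhoK beta_gt0 zI c0 Bcor tge0 wsol Bub sT'; apply.
have [wM _ _] := wsol.
have bnd r : t <= r <= t + T ->
    gap (w r) - 3 * c <= Z r <= gap (w r) + 2 * c.
  move=> rT; have [_ yS _] := wM r rT; have /andP[tr _] := rT.
  have := leq_trans (ht0 t tt0) (clock_nondecreasing tge0 tr).
  rewrite geq_max => /andP[n1 n2].
  have h1 := hN1 _ _ n1 yS; have h2 := hN2 _ _ n2 yS.
  have h3 := value_le_best A rho_good rhoK th_gt0 zI (clock r) yS.
  by move: h1; rewrite ler_norml /gap /Z => /andP[? ?]; apply/andP; split; lra.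
have ts : t <= t + s <= t + T by rewrite lerDl (ltW s0) lerD2l.
have tt : t <= t <= t + T by rewrite lexx lerDl ltW.
have /andP[b1 _] := bnd _ ts; have /andP[_ b2] := bnd _ tt.
have ge : gap (w t) <= Num.max (gap (w t)) 0 by rewrite le_max lexx.
have V0 : 0 <= Num.max (gap (w t)) 0 by rewrite le_max lexx orbT.
have es := expR_gt0 (- s); set V := Num.max (gap (w t)) 0 in ge V0 *.
have h : expR (- s) * (Z t - 3 * c) <= expR (- s) * V by rewrite ler_pM2l//; lra.
rewrite ge_max addr_ge0 ?mulr_ge0 ?(ltW es) ?(ltW e0)// andbT.
by move: b1 dec h; rewrite /c; lra.
Qed.

Let incl := smooth_br_incl A rho beta.

(* 0 is included so that the supremum is nonnegative. *)
Let excess (t T : R) : set R := [set r | r = 0 \/ exists (w : R -> state) s,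
  [/\ solution incl (state_space A) t (t + T) w, 0 < s <= T &
      r = smooth_gap (t + s, w (t + s)) - expR (- s) * smooth_gap (t, w t)]].

Let excess_ub t T (e : R) : 0 <= t -> 0 <= e ->
  (forall (w : R -> state) s, solution incl (state_space A) t (t + T) w -> 0 < s <= T ->
    smooth_gap (t + s, w (t + s)) <= expR (- s) * smooth_gap (t, w t) + e) ->
  ubound (excess t T) e.
Proof.
by move=> t0 e0 h r [->//|[w [s [wsol sT ->]]]]; rewrite lerBlDl; exact: h.
Qed.

Let has_sup_excess t T : 0 <= t -> has_sup (excess t T).
Proof.
move=> t0; split; first by exists 0; left.
have l0 : 0 <= ln (p.+2%:R : R) by rewrite ln_ge0// ler1n.
exists (2 * `|A| + ln p.+2%:R); apply: excess_ub => //; first by rewrite addr_ge0// mulr_ge0.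
move=> w s [wM _ _] /andP[s0 sT].
have ts : t <= t + s <= t + T by rewrite lerDl (ltW s0) lerD2l.
have ts0 : 0 <= t + s by rewrite addr_ge0// ltW.
apply: (le_trans (smooth_gap_le _ ts0)).
have h1 := gap_bound (wM _ ts); have /andP[_ h2] := smooth_gap_errorS ts0.
have : 0 <= expR (- s) * smooth_gap (t, w t) by rewrite mulr_ge0 ?expR_ge0// smooth_gap_ge0.
lra.
Qed.

(** With [eps t T] the supremum of the excess, the decay inequality holds by construction for all
    [t > 0]; that this supremum vanishes for large [t] comes from [gap_decay] and the smoothing
    error. *)
Lemma smooth_gap_lyapunov :
  global_uniform_lyapunov incl (state_space A) (consistent_set A) smooth_gap.
Proof.
have err_cvg e : 0 < e -> exists2 t0 : R, 0 <= t0 & forall t, t0 <= t -> smooth_gap_error t <= e.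
  move=> e0; have l0 : 0 <= ln (p.+2%:R : R) by rewrite ln_ge0// ler1n.
  exists (ln p.+2%:R / e); first by rewrite divr_ge0// ltW.
  move=> t; rewrite ler_pdivrMr// => te.
  have t0 : 0 <= t by rewrite -(pmulr_lge0 _ e0); exact: le_trans te.
  rewrite /smooth_gap_error mulrC ler_pdivrMr ?ltr_wpDl//; apply: (le_trans te).
  by rewrite mulrC ler_pM2l// lerDl.
split.
- by split; [exact: consistent_set_compact|move=> w []].
- exact: smooth_gap_smooth.
- by move=> t w t0 _; exact: smooth_gap_ge0.
- apply/seteqP; split=> w /=.
    move=> [wM wA]; split => //; exists (fun n => n%:R); split => //.
    + by move=> m n mn; rewrite ler_nat.
    + exact: cvgr_idn.
    + apply/cvgrPdist_le => e /err_cvg[t0 t00 ht0].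
      exists (Num.trunc t0).+1 => // n /= tn; rewrite sub0r normrN ger0_norm ?smooth_gap_ge0//.
      apply: (le_trans (smooth_gap_le _ (ler0n _ _))).
      rewrite max_r// add0r; apply: ht0; apply: ltW; apply: lt_le_trans (truncnS_gt t0) _.
      by rewrite ler_nat.
  move=> [wM [s [s0 _ _ sw]]]; split => //.
  (* At all times the function is at least the gap of [w], so a positive gap excludes the limit
     [0]. *)
  apply: (@le_trans _ _ 0) => //; rewrite leNgt; apply/negP => w0.
  move/cvgrPdist_lt : sw => /(_ _ w0)[n _ /(_ n (leqnn n))].
  rewrite /= sub0r normrN ger0_norm ?smooth_gap_ge0//.
  by apply/negP; rewrite -leNgt; exact: gap_le_smooth.
- exists (fun T => expR (- T)), (fun t T => sup (excess t T)); split.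
  + by move=> T T0; rewrite expR_gt0 -expR0 ltr_expR oppr_lt0.
  + by move=> t T t0 _; apply: ub_le_sup; [exact: (has_sup_excess T t0).2|left].
  + exact: cvgr_expR.
  + move=> T T0; apply/cvgrPdist_le => e e0.
    have [t1 t10 h1] := gap_decay (divr_gt0 e0 (ltr0n R 2)).
    have [t2 t20 h2] := err_cvg _ (divr_gt0 e0 (ltr0n R 2)).
    exists (Num.max t1 t2); split; first exact: num_real.
    move=> t; rewrite gt_max => /andP[/ltW tt1 /ltW tt2] /=.
    have t0 : 0 <= t by exact: le_trans tt1.
    have [ne ub] := has_sup_excess T t0.
    rewrite sub0r normrN ger0_norm; last by apply: ub_le_sup => //; left.
    apply: ge_sup => //; apply: excess_ub => //; first exact: ltW.
    move=> w s wsol /[dup] sT /andP[s0 _].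
    have ts0 : 0 <= t + s by rewrite addr_ge0// ltW.
    apply: (le_trans (smooth_gap_le _ ts0)).
    have g1 := h1 t T w tt1 T0 wsol s sT.
    have g2 : smooth_gap_error (t + s) <= e / 2.
      by apply: h2; rewrite (le_trans tt2)// lerDl ltW.
    have g3 : expR (- s) * Num.max (gap (w t)) 0 <= expR (- s) * smooth_gap (t, w t).
      by rewrite ler_pM2l ?expR_gt0// ge_max gap_le_smooth// smooth_gap_ge0.
    lra.
  + move=> t T w t0 T0 wsol s sT; rewrite -lerBlDl.
    apply: ub_le_sup; first exact: (has_sup_excess T (ltW t0)).2.
    by right; exists w, s.
Qed.

End Lyapunov.

Theorem theorem3p8 (R : realType) (p q : nat) (A : 'M[R]_(p.+1, q.+1))
    (rho : 'rV[R]_p.+1 -> R) (beta : R^nat) :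
  good_perturbation rho ->
  nondecreasing_seq beta ->
  (forall n, 0 < beta n) ->
  beta @ \oo --> +oo ->
  exists Phi : R * ('rV[R]_p.+1 * 'rV[R]_q.+1 * R) -> R,
    global_uniform_lyapunov (smooth_br_incl A rho beta) (state_space A)
      (consistent_set A) Phi.
Proof.
move=> rho_good beta_incr beta_gt0 beta_cvgy.
by exists (smooth_gap A); exact: smooth_gap_lyapunov.
Qed.
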